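(* Let $S$ be a spacelike surface immersed in a locally conformally flat 4-dimensional Lorentzian manifold $(\mathcal V,g)$ (for instance, a Lorentz space form). Then $S$ is umbilical along a normal direction if and only if its normal curvature vanishes, $R^\perp=0$.
   Context: $(\mathcal V,g)$ is a 4-dimensional, oriented and time-oriented Lorentzian manifold of signature $(-,+,+,+)$ with Levi-Civita connection $\nabla$. $S$ is an immersed 2-dimensional surface, identified locally with its image (considerations are local, so $S$ may be taken embedded and oriented), which is spacelike: the induced metric $\bar g$ is positive definite. For $x\in S$, $T_x\mathcal V=T_xS\oplus T_xS^\perp$, and superscripts $T$ and $\perp$ on vectors denote tangential and normal components. The normal connection is $D_XN=(\nabla_XN)^\perp$, and the normal curvature is $R^\perp(X,Y)N=D_XD_YN-D_YD_XN-D_{[X,Y]}N$, for $X,Y$ tangent and $N$ normal to $S$. The Weingarten operator of a normal field $N$ is $A_N(X)=(\nabla_XN)^T$ for $X$ tangent to $S$; at each point it depends only on $N|_x\in T_xS^\perp$. The mean curvature vector $H$ is the trace with respect to $\bar g$ of the shape tensor $\mathrm{II}(X,Y)=-(\nabla_XY)^\perp$, so $\mathrm{tr}A_N=g(H,N)$. A point $x\in S$ is umbilical along $N\in T_xS^\perp$ if $A_N|_x=\frac12 g(H,N)\,\mathbf 1$. $S$ is umbilical along a normal direction if for each $x\in S$ there is a nonzero $N\in T_xS^\perp$ along which $x$ is umbilical. *)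

(* Defs.v *)
From HB Require Import structures.
From mathcomp Require Import all_boot all_order all_algebra.
From mathcomp Require Import all_classical all_reals all_analysis.
Set Implicit Arguments.
Unset Strict Implicit.
Unset Printing Implicit Defensive.
Import Order.TTheory GRing.Theory Num.Theory numFieldNormedType.Exports.
Local Open Scope classical_set_scope.
Local Open Scope ring_scope.

(* Tangent vectors are row vectors of components in a chart; a differential
   acts as [v *m 'J f x]. *)

Section Smoothness.
Context {R : realType} {m : nat} {W : normedModType R}.

Definition partials (s : seq 'I_m) (f : 'rV[R]_m -> W) : 'rV[R]_m -> W :=
  foldr (fun i h => 'D_(delta_mx 0 i) h) f s.

(* C^oo on an open set [U]: every iterated partial derivative is
   (Frechet-)differentiable at every point of [U]. *)
Definition smooth_on (U : set 'rV[R]_m) (f : 'rV[R]_m -> W) : Prop :=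
  forall (s : seq 'I_m) (x : 'rV[R]_m), U x -> differentiable (partials s f) x.

End Smoothness.

(* A manifold carries one preferred chart [coord p] around each of its points
   [p], with domain [dom p] and inverse [param p]; these charts form the atlas.
   [T_p M] is identified with ['rV_n] through the chart [coord p].  Outside
   [dom p] and [img p] the values of [coord p] and [param p] are junk. *)
Record manifold (R : realType) (n : nat) : Type := Manifold {
  carrier :> topologicalType;
  dom : carrier -> set carrier;
  coord : carrier -> carrier -> 'rV[R]_n;
  param : carrier -> 'rV[R]_n -> carrier;
  manifold_hausdorff : hausdorff_space carrier;
  manifold_second_countable : @second_countable carrier;
  dom_center : forall p, dom p p;
  dom_open : forall p, open (dom p);
  img_open : forall p, open (coord p @` dom p);
  coordK : forall p q, dom p q -> param p (coord p q) = q;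
  coord_continuous : forall p q, dom p q -> {for q, continuous (coord p)};
  param_continuous : forall p x,
    (coord p @` dom p) x -> {for x, continuous (param p)};
  transition_smooth : forall p q,
    smooth_on (coord p @` (dom p `&` dom q)) (coord q \o param p)
}.

Section Manifolds.
Context {R : realType} {n : nat} (M : manifold R n).

Definition img (p : M) : set 'rV[R]_n := coord p @` dom p.
Definition overlap (p q : M) : set 'rV[R]_n := coord p @` (dom p `&` dom q).
Definition transition (p q : M) : 'rV[R]_n -> 'rV[R]_n := coord q \o param p.

(* The atlas is an oriented one. *)
Definition oriented : Prop :=
  forall p q x, overlap p q x -> 0 < \det ('J (transition p q) x).

End Manifolds.

Definition ip {R : realType} {n : nat} (G : 'M[R]_n) (v w : 'rV[R]_n) : R :=
  (v *m G *m w^T) 0 0.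

Definition minkowski {R : realType} : 'M[R]_4 :=
  diag_mx (\row_i (if i == 0 then -1 else 1)).

Definition lorentzian {R : realType} (G : 'M[R]_4) : Prop :=
  G^T = G /\ exists2 P, P \in unitmx & P *m G *m P^T = minkowski.

(* [metric_mx p x] is the Gram matrix of the coordinate basis of [coord p]
   at the point of coordinates [x]. *)
Record lorentz_metric (R : realType) (V : manifold R 4) : Type := LorentzMetric {
  metric_mx :> V -> 'rV[R]_4 -> 'M[R]_4;
  metric_smooth : forall p, smooth_on (img p) (metric_mx p);
  metric_lorentzian : forall p x, img p x -> lorentzian (metric_mx p x);
  metric_transition : forall p q x, overlap p q x ->
    metric_mx p x = 'J (transition p q) x
                    *m metric_mx q (transition p q x)
                    *m ('J (transition p q) x)^T
}.

(* A global continuous timelike vector field, given by its components in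
   every chart. *)
Record time_orientation (R : realType) (V : manifold R 4)
    (g : lorentz_metric V) : Type := TimeOrientation {
  time_field : V -> 'rV[R]_4 -> 'rV[R]_4;
  time_continuous : forall p x, img p x -> {for x, continuous (time_field p)};
  time_timelike : forall p x, img p x ->
    ip (g p x) (time_field p x) (time_field p x) < 0;
  time_transition : forall p q x, overlap p q x ->
    time_field q (transition p q x) = time_field p x *m 'J (transition p q) x
}.

(* [christoffel G x v w] is the vector [\sum_(i, j) Gamma^k_ij v^i w^j]. *)
Definition christoffel {R : realType} {n : nat} (G : 'rV[R]_n -> 'M[R]_n)
    (x v w : 'rV[R]_n) : 'rV[R]_n :=
  \row_k (2^-1 * \sum_i \sum_j \sum_l
    v 0 i * w 0 j * invmx (G x) k l *
    ('D_(delta_mx 0 i) G x j l + 'D_(delta_mx 0 j) G x i l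
     - 'D_(delta_mx 0 l) G x i j)).

Definition bracket {R : realType} {m : nat} (X Y : 'rV[R]_m -> 'rV[R]_m) :
    'rV[R]_m -> 'rV[R]_m :=
  fun u => 'D_(X u) Y u - 'D_(Y u) X u.

(* Levi-Civita covariant derivative, along [phi], of the vector field [N]
   along [phi].  For [phi := id] it is the Levi-Civita connection of [G]. *)
Definition cov {R : realType} {m n : nat} (G : 'rV[R]_n -> 'M[R]_n)
    (phi : 'rV[R]_m -> 'rV[R]_n)
    (X : 'rV[R]_m -> 'rV[R]_m) (N : 'rV[R]_m -> 'rV[R]_n) :
    'rV[R]_m -> 'rV[R]_n :=
  fun u => 'D_(X u) N u + christoffel G (phi u) (X u *m 'J phi u) (N u).

Definition curvature {R : realType} {m n : nat}
    (D : ('rV[R]_m -> 'rV[R]_m) -> ('rV[R]_m -> 'rV[R]_n) ->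
         ('rV[R]_m -> 'rV[R]_n))
    (X Y : 'rV[R]_m -> 'rV[R]_m) (N : 'rV[R]_m -> 'rV[R]_n) :
    'rV[R]_m -> 'rV[R]_n :=
  fun u => D X (D Y N) u - D Y (D X N) u - D (bracket X Y) N u.

Definition flat_on {R : realType} {n : nat} (U : set 'rV[R]_n)
    (G : 'rV[R]_n -> 'M[R]_n) : Prop :=
  forall X Y Z : 'rV[R]_n -> 'rV[R]_n,
    smooth_on U X -> smooth_on U Y -> smooth_on U Z ->
    forall x, U x -> curvature (cov G id) X Y Z x = 0.

(* Every point has a neighbourhood on which [e^(2c) g] is flat for some smooth
   function [c]. *)
Definition locally_conformally_flat {R : realType} {V : manifold R 4}
    (g : lorentz_metric V) : Prop :=
  forall p : V, exists (U : set 'rV[R]_4) (c : 'rV[R]_4 -> R^o),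
    [/\ open U, U (coord p p), U `<=` img p, smooth_on U c &
        flat_on U (fun x => expR (2 * c x) *: g p x)].

(* Local extrinsic geometry of a parametrized surface [phi] for the metric
   components [G]; [u] is a point of the parameter domain. *)
Section Surfaces.
Context {R : realType} (G : 'rV[R]_4 -> 'M[R]_4) (phi : 'rV[R]_2 -> 'rV[R]_4).
Implicit Types (u v w : 'rV[R]_2) (X Y : 'rV[R]_2 -> 'rV[R]_2)
  (N : 'rV[R]_2 -> 'rV[R]_4).

Definition induced u : 'M[R]_2 :=
  'J phi u *m G (phi u) *m ('J phi u)^T.

Definition positive_definite (h : 'M[R]_2) : Prop :=
  forall v, v != 0 -> 0 < ip h v v.

Definition normal_at u (a : 'rV[R]_4) : Prop :=
  forall v, ip (G (phi u)) a (v *m 'J phi u) = 0.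

(* [tan_part u a] is the only vector tangent to the surface at [u] with
   [normal_at u (a - tan_part u a)]. *)
Definition tan_part u (a : 'rV[R]_4) : 'rV[R]_4 :=
  a *m G (phi u) *m ('J phi u)^T *m invmx (induced u) *m 'J phi u.

Definition nor_part u (a : 'rV[R]_4) : 'rV[R]_4 := a - tan_part u a.

Definition normal_conn X N : 'rV[R]_2 -> 'rV[R]_4 :=
  fun u => nor_part u (cov G phi X N u).

(* As a vector of the ambient tangent space. *)
Definition weingarten N u v : 'rV[R]_4 := tan_part u (cov G phi (cst v) N u).

Definition shape u v w : 'rV[R]_4 :=
  - nor_part u (cov G phi (cst v) (fun u' => w *m 'J phi u') u).

Definition mean_curvature u : 'rV[R]_4 :=
  \sum_i \sum_j invmx (induced u) i j
    *: shape u (delta_mx 0 i) (delta_mx 0 j).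

Definition smooth_normal_field (O : set 'rV[R]_2) N : Prop :=
  smooth_on O N /\ forall u, O u -> normal_at u (N u).

End Surfaces.

Section Immersions.
Context {R : realType} {S : manifold R 2} {V : manifold R 4}.
Variables (g : lorentz_metric V) (f : S -> V).

Definition local_dom (s : S) : set 'rV[R]_2 :=
  coord s @` (dom s `&` f @^-1` dom (f s)).

Definition local_rep (s : S) : 'rV[R]_2 -> 'rV[R]_4 :=
  coord (f s) \o f \o param s.

Definition smooth_immersion : Prop :=
  [/\ continuous f,
      forall s, smooth_on (local_dom s) (local_rep s) &
      forall s u, local_dom s u -> \rank ('J (local_rep s) u) = 2%N].

Definition spacelike : Prop :=
  forall s u, local_dom s u ->
    positive_definite (induced (g (f s)) (local_rep s) u).

(* [a] is a normal vector at [s].  The Weingarten operator at [s] depends only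
   on the value at [s] of the field [N], so the choice of the extension [N] of
   [a] is immaterial. *)
Definition umbilical_along (s : S) (a : 'rV[R]_4) : Prop :=
  let G := g (f s) in let phi := local_rep s in let u := coord s s in
  exists (O : set 'rV[R]_2) (N : 'rV[R]_2 -> 'rV[R]_4),
    [/\ open O, O u, O `<=` local_dom s, smooth_normal_field G phi O N &
        N u = a /\
        forall v : 'rV[R]_2, weingarten G phi N u v =
          (2^-1 * ip (G (phi u)) (mean_curvature G phi u) a)
            *: (v *m 'J phi u)].

Definition umbilical_along_normal_direction : Prop :=
  forall s : S, exists a : 'rV[R]_4,
    [/\ a != 0, normal_at (g (f s)) (local_rep s) (coord s s) a &
        umbilical_along s a].

(* R^perp = 0, tested at each point on smooth fields defined near it. *)
Definition normal_curvature_vanishes : Prop :=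
  forall (s : S) (O : set 'rV[R]_2) (X Y : 'rV[R]_2 -> 'rV[R]_2)
    (N : 'rV[R]_2 -> 'rV[R]_4),
    open O -> O (coord s s) -> O `<=` local_dom s ->
    smooth_on O X -> smooth_on O Y ->
    smooth_normal_field (g (f s)) (local_rep s) O N ->
    curvature (normal_conn (g (f s)) (local_rep s)) X Y N (coord s s) = 0.

End Immersions.

(* Main.v *)
Require Import Defs.
From mathcomp Require Import all_boot all_order all_algebra.
From mathcomp Require Import all_classical all_reals all_analysis.
From mathcomp Require Import ring lra.
Set Implicit Arguments.
Unset Strict Implicit.
Unset Printing Implicit Defensive.
Import Order.TTheory GRing.Theory Num.Theory numFieldNormedType.Exports.
Local Open Scope classical_set_scope.
Local Open Scope ring_scope.

(** At a point of the surface let [h] be the first fundamental form and, for a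
    normal vector [a], let [B a] be the second fundamental form in the direction
    [a], that is, the symmetric two-by-two matrix of entries
    [g(nabla_(e_i) e_k, a)].  The point is umbilical along [a] exactly when [B a]
    is a multiple of [h] ([umbilicP]).

    If the ambient metric is conformally flat, the Ricci equation has no ambient
    curvature term: the component along a normal vector [b] of the normal
    curvature applied to [N] is the antisymmetric part of [B N h^-1 B b]
    ([ricci_conformally_flat]).  In dimension two this antisymmetric part is one
    number, and up to the factor [det h] it is the triple product of [B N], [h]
    and [B b] in the three-dimensional space of symmetric matrices
    ([triple_commutator]).  The normal curvature therefore vanishes if and only
    if [B N], [h] and [B b] are coplanar for all normal vectors [N] and [b].

    The normal space is a plane.  If [a] is a nonzero normal vector with [B a] a
    multiple of [h], any two normal vectors [N] and [b] satisfy a linear relation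
    with [a], and this relation makes [B N], [B b] and [h] coplanar
    ([umbilic_normal_flat]).  Conversely, let [n1], [n2] be a basis of the normal
    plane.  If [B n1], [h] and [B n2] are coplanar, then
    [x *: B n1 + y *: B n2 = z *: h] with [x], [y] not both zero, because [h] is
    not zero, and [x *: n1 + y *: n2] is an umbilical direction
    ([normal_flat_umbilic]).

    The Ricci equation is obtained without the curvature tensor of [g].  Let
    [e^(2c) g] be flat.  On normal fields the normal connection of [g] is that of
    [e^(2c) g] minus the closed one-form [d(c o phi)] ([normal_covd_conformal]),
    which does not contribute to the curvature.  The normal curvature is thus the
    one of a surface in a flat space, where only the tangential parts of the
    derivatives contribute ([normal_covd_commutator]).  The second fundamental
    form of the flat metric is, up to the conformal factor, [B a - dc(a) h], and
    the terms in [h] disappear from the antisymmetric part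
    ([antisym_conformal]).

    Vectors are rows, so that linear maps act on the right, and a connection is
    given by the matrices of its coordinate derivatives ([christoffel_mx] on the
    ambient space, [pullback] on the surface).  The analytic input is the
    symmetry of second derivatives ([derive_comm_real]) and the stability of
    smoothness under algebraic operations and composition ([smooth_expr]). *)

(** * Differentiability and the symmetry of second derivatives *)

Section Differentiation.
Context {R : realType}.

Lemma near_eq_differentiable (V W : normedModType R) (f g : V -> W) (x : V) :
  (\near x, f x = g x) -> differentiable f x -> differentiable g x.
Proof.
move=> fg dfx; have fgx : f x = g x by exact: nbhs_singleton fg.
have [dc df] := (diff_locallyP x f).1 dfx.
have exp_g : g \o shift x = cst (g x) + 'd f x +o_ 0 id.
  have /eqaddoP df0 := df; rewrite -fgx; apply/eqaddoP => e e0.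
  have fg0 : \forall h \near (0 : V), f (h + x) = g (h + x).
    by move: fg; rewrite (near_shift 0 x) /=; apply: filterS => h; rewrite subr0.
  by apply: filterS2 fg0 (df0 e e0) => h; rewrite /= /shift /= !fctE /= => ->.
apply/diff_locallyP.
by rewrite (diff_unique dc exp_g).
Qed.

Lemma is_derive_line (V W : normedModType R) (f : V -> W) (a v : V) (s : R) :
  differentiable f (s *: v + a) ->
  is_derive s (1 : R) (fun t : R => f (t *: v + a)) ('D_v f (s *: v + a)).
Proof.
move=> /(@diff_derivable _ _ _ _ _ v) df.
have E : (fun h : R => h^-1 *: (f ((h *: 1 + s) *: v + a) - f (s *: v + a)))
   = (fun h => h^-1 *: (f (h *: v + (s *: v + a)) - f (s *: v + a))).
  by apply/funext => h; rewrite [h *: 1]mulr1 scalerDl addrA.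
split.
  by rewrite /derivable E.
by rewrite /derive E.
Qed.

Lemma differentiable_bound (V W : normedModType R) (f : V -> W) (x : V) (e : R) :
  differentiable f x -> 0 < e ->
  exists2 d, 0 < d & forall h, `|h| < d ->
    `|f (h + x) - f x - 'd f x h| <= e * `|h|.
Proof.
move=> /diff_locallyP [_ /eqaddoP df] e0.
have /nbhs_ballP[d /= d0 H] := df e e0.
exists d => // h hd; have := H h; rewrite -ball_normE /= sub0r normrN => /(_ hd).
by rewrite !fctE /= opprD addrA.
Qed.

(** The mean value theorem along [v] turns the second difference into [t] times a
    difference of values of ['D_v f], which the differentiability of ['D_v f] at
    [x] estimates.  The second difference is symmetric in [v] and [w] but the
    derivative in the estimate is not visibly so: comparing the two versions of
    the estimate makes mixed derivatives commute. *)
Lemma second_difference_bound (V : normedModType R) (f : V -> R) (x v w : V) (e : R) :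
  (\forall y \near x, differentiable f y) ->
  differentiable ('D_v f : V -> R) x -> 0 < e ->
  exists2 d, 0 < d & forall t, 0 < t -> t < d ->
    `|(f (t *: v + (t *: w + x)) - f (t *: v + x) - f (t *: w + x) + f x)
      - t ^+ 2 * 'D_w ('D_v f) x| <= e * t ^+ 2.
Proof.
move=> /nbhs_ballP[d1 /= d10 df] dDf e0.
set K := 2 * `|v| + `|w| + 1.
have K0 : 0 < K by rewrite /K; do 2?[rewrite addr_ge0 ?ltr_wpDl //]; rewrite ?mulr_ge0.
have eK0 : 0 < e / K by rewrite divr_gt0.
have [d2 d20 bnd] := differentiable_bound dDf eK0.
(* [K] bounds the norms of all the vectors reached from [x], divided by [t]. *)
exists (Num.min d1 d2 / K); first by rewrite divr_gt0 // lt_min d10.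
move=> t t0; rewrite ltr_pdivlMr // lt_min => /andP[td1 td2].
have bndv s : 0 <= s -> s <= t -> `|s *: v| <= t * `|v|.
  by move=> s0 st; rewrite normrZ ger0_norm // ler_wpM2r.
have bndw : `|t *: w| = t * `|w| by rewrite normrZ gtr0_norm.
have tK : t * K = t * `|v| + t * `|v| + t * `|w| + t by rewrite /K; ring.
have v0 : 0 <= t * `|v| by rewrite mulr_ge0 // ltW.
have w0 : 0 <= t * `|w| by rewrite mulr_ge0 // ltW.
have bvw s : 0 <= s -> s <= t -> `|s *: v + t *: w| <= t * `|v| + t * `|w|.
  by move=> s0 st; rewrite (le_trans (ler_normD _ _)) // bndw lerD2r bndv.
have dfv s : 0 <= s -> s <= t -> differentiable f (s *: v + x).
  move=> s0 st; apply: df; rewrite -ball_normE /= distrC addrK.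
  by rewrite (le_lt_trans (bndv s s0 st)) //; lra.
have dfvw s : 0 <= s -> s <= t -> differentiable f (s *: v + (t *: w + x)).
  move=> s0 st; apply: df; rewrite -ball_normE /= distrC addrA addrK.
  by rewrite (le_lt_trans (bvw s s0 st)) //; lra.
pose phi s := f (s *: v + (t *: w + x)) - f (s *: v + x).
pose dphi s := 'D_v f (s *: v + (t *: w + x)) - 'D_v f (s *: v + x).
have Dphi s : 0 <= s -> s <= t -> is_derive s (1 : R) phi (dphi s).
  by move=> s0 st; apply: is_deriveB; apply: is_derive_line; [exact: dfvw|exact: dfv].
have [||c /[!in_itv]/= /andP[c0 ct] E] := @MVT R phi dphi 0 t t0.
- by move=> s /[!in_itv]/= /andP[s0 st]; apply: Dphi; apply: ltW.
- apply: derivable_within_continuous => s /[!in_itv]/= /andP[s0 st].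
  by have [] := Dphi s s0 st.
have -> : f (t *: v + (t *: w + x)) - f (t *: v + x) - f (t *: w + x) + f x
   = phi t - phi 0 by rewrite /phi !scale0r !add0r opprB addrA; ring.
rewrite E subr0 /dphi.
have {}c0 := ltW c0; have {}ct := ltW ct.
have := bnd (c *: v + t *: w); have := bnd (c *: v).
rewrite addrA.
set a1 := 'D_v f (c *: v + x); set a2 := 'D_v f (c *: v + t *: w + x).
rewrite (deriveE w dDf) linearD [X in _ - (_ + X)]linearZ /=.
move: ('d ('D_v f) x) => L.
set a0 := 'D_v f x; set p := L (c *: v); set q := L w.
have B1 := bndv c c0 ct; have B2 := bvw c c0 ct.
move=> /(_ ltac:(by apply: le_lt_trans B1 _; lra)) H1.
move=> /(_ ltac:(by apply: le_lt_trans B2 _; lra)) H2.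
have : `|a2 - a1 - t * q| <= e * t.
  have -> : a2 - a1 - t * q = (a2 - a0 - (p + t * q)) - (a1 - a0 - p) by ring.
  apply: (le_trans (ler_normB _ _)); apply: (le_trans (lerD H2 H1)).
  rewrite -mulrDr -mulrA; apply: ler_wpM2l; first exact: ltW.
  by rewrite ler_pdivrMl // mulrC; lra.
move=> H; rewrite (_ : _ - _ = t * (a2 - a1 - t * q)); last by ring.
rewrite normrM gtr0_norm // expr2 mulrCA.
by rewrite ler_wpM2l // ltW.
Qed.

Lemma derive_comm_real (V : normedModType R) (f : V -> R) (x v w : V) :
  (\forall y \near x, differentiable f y) ->
  differentiable ('D_v f : V -> R) x -> differentiable ('D_w f : V -> R) x ->
  'D_w ('D_v f) x = 'D_v ('D_w f) x.
Proof.
move=> df dv dw; apply/eqP; rewrite -subr_eq0 -normr_eq0 eq_le normr_ge0 andbT.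
apply/ler_addgt0Pr => e e0; rewrite add0r.
have e20 : 0 < e / 2 by rewrite divr_gt0.
have [d1 d10 H1] := second_difference_bound w df dv e20.
have [d2 d20 H2] := second_difference_bound v df dw e20.
have [t t0 [td1 td2]] : exists2 t, 0 < t & t < d1 /\ t < d2.
  exists (Num.min d1 d2 / 2); first by rewrite divr_gt0 // lt_min d10.
  have m0 : 0 < Num.min d1 d2 by rewrite lt_min d10.
  have : Num.min d1 d2 / 2 < Num.min d1 d2 by lra.
  by rewrite lt_min => /andP.
have {}H1 := H1 t t0 td1; have {}H2 := H2 t t0 td2.
rewrite addrCA in H2.
move: H1 H2; set A := 'D_w _ _; set B := 'D_v _ _; set D := f (_ + (_ + _)).
move=> H1 H2.
have t20 : 0 < t ^+ 2 by rewrite exprn_gt0.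
rewrite -(ler_pM2l t20) -{1}(gtr0_norm t20) -normrM.
set D2 := D - _ - _ + f x in H1; set D3 := D - _ - _ + f x in H2.
have DD : D2 = D3 by rewrite /D2 /D3; ring.
rewrite (_ : _ * _ = (D3 - t ^+ 2 * B) - (D2 - t ^+ 2 * A)); last by rewrite DD; ring.
have -> : t ^+ 2 * e = e / 2 * t ^+ 2 + e / 2 * t ^+ 2.
  by rewrite -mulrDl -splitr mulrC.
exact: (le_trans (ler_normB _ _) (lerD H2 H1)).
Qed.

End Differentiation.

(** * Calculus of matrix-valued functions *)

Section MatrixCalculus.
Context {R : realType}.

Lemma differentiable_entry (V : normedModType R) p q (A : V -> 'M[R]_(p, q)) x i j :
  differentiable A x -> differentiable (fun y => A y i j : R) x.
Proof.
move=> dA.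
exact: (differentiable_comp dA (differentiable_coord (A x) i j)).
Qed.

Lemma differentiable_mx (V : normedModType R) p q (A : V -> 'M[R]_(p, q)) x :
  (forall i j, differentiable (fun y => A y i j : R) x) -> differentiable A x.
Proof.
move=> dA.
have -> : A = \sum_i \sum_j (fun y => A y i j *: delta_mx i j).
  apply/funext => y; rewrite fct_sumE [LHS]matrix_sum_delta.
  by apply: eq_bigr => i _; rewrite fct_sumE.
by do 2!apply: differentiable_sum => ?; exact: differentiableZl.
Qed.

Lemma derive_entry (V : normedModType R) p q (A : V -> 'M[R]_(p, q)) x v i j :
  differentiable A x -> ('D_v A x) i j = 'D_v (fun y => A y i j : R) x.
Proof. by move=> dA; rewrite derive_mx ?mxE //; exact: diff_derivable. Qed.

Lemma derive_lincomb m (W : normedModType R) (f : 'rV[R]_m -> W) x v :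
  differentiable f x -> 'D_v f x = \sum_k v 0 k *: 'D_(delta_mx 0 k) f x.
Proof.
move=> df; rewrite deriveE // {1}(row_sum_delta v) linear_sum.
by apply: eq_bigr => k _; rewrite linearZ /= deriveE.
Qed.

Lemma derive_comp_lincomb (V : normedModType R) n (W : normedModType R)
    (g : 'rV[R]_n -> W) (phi : V -> 'rV[R]_n) x v :
  differentiable phi x -> differentiable g (phi x) ->
  'D_v (fun y => g (phi y)) x
  = \sum_k 'D_v phi x 0 k *: 'D_(delta_mx 0 k) g (phi x).
Proof.
move=> dphi dg; rewrite deriveE; last exact: (differentiable_comp dphi dg).
rewrite (diff_comp dphi dg) /= -deriveE // -deriveE //.
exact: derive_lincomb.
Qed.

Lemma differentiable_mulmx (V : normedModType R) p q r
    (A : V -> 'M[R]_(p, q)) (B : V -> 'M[R]_(q, r)) x :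
  differentiable A x -> differentiable B x -> differentiable (fun y => A y *m B y) x.
Proof.
move=> dA dB; apply: differentiable_mx => i j.
have -> : (fun y => (A y *m B y) i j : R)
    = \sum_k ((fun y => A y i k : R) * (fun y => B y k j : R)).
  by apply/funext => y; rewrite fct_sumE mxE.
by apply: differentiable_sum => k; apply: differentiableM; exact: differentiable_entry.
Qed.

Lemma derive_mulmx (V : normedModType R) p q r
    (A : V -> 'M[R]_(p, q)) (B : V -> 'M[R]_(q, r)) x v :
  differentiable A x -> differentiable B x ->
  'D_v (fun y => A y *m B y) x = 'D_v A x *m B x + A x *m 'D_v B x.
Proof.
move=> dA dB; apply/matrixP => i j.
rewrite derive_entry; last exact: differentiable_mulmx.
have -> : (fun y => (A y *m B y) i j : R)
    = \sum_k ((fun y => A y i k : R) * (fun y => B y k j : R)).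
  by apply/funext => y; rewrite fct_sumE mxE.
have dAe k := @diff_derivable _ _ _ _ _ v (differentiable_entry i k dA).
have dBe k := @diff_derivable _ _ _ _ _ v (differentiable_entry k j dB).
rewrite derive_sum; last by move=> k; exact: derivableM.
rewrite !mxE -big_split /=; apply: eq_bigr => k _.
rewrite (deriveM (dAe k) (dBe k)) (derive_entry _ _ _ dA) (derive_entry _ _ _ dB) addrC.
congr (_ + _).
by rewrite /GRing.scale /= mulrC.
Qed.

Lemma differentiable_trmx (V : normedModType R) p q (A : V -> 'M[R]_(p, q)) x :
  differentiable A x -> differentiable (fun y => (A y)^T) x.
Proof.
move=> dA; apply: differentiable_mx => i j.
by under eq_fun do rewrite mxE; exact: differentiable_entry.
Qed.

Lemma derive_trmx (V : normedModType R) p q (A : V -> 'M[R]_(p, q)) x v :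
  differentiable A x -> 'D_v (fun y => (A y)^T) x = ('D_v A x)^T.
Proof.
move=> dA; apply/matrixP => i j; rewrite mxE (derive_entry _ _ _ dA).
rewrite (derive_entry _ _ _ (differentiable_trmx dA)).
by under eq_fun do rewrite mxE.
Qed.

Lemma derive_scalemx (V : normedModType R) p q (f : V -> R) (A : V -> 'M[R]_(p, q)) x v :
  differentiable f x -> differentiable A x ->
  'D_v (fun y => f y *: A y) x = 'D_v f x *: A x + f x *: 'D_v A x.
Proof.
move=> df dA.
have -> : (fun y => f y *: A y) = (fun y => (f y)%:M *m A y).
  by apply/funext => y; rewrite mul_scalar_mx.
have df' : differentiable (fun y => (f y)%:M : 'M[R]_p) x.
  apply: differentiable_mx => i j; under eq_fun do rewrite mxE.
  by case: (i == j); [exact: df|exact: (differentiable_cst (0 : R))].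
rewrite (derive_mulmx v df' dA) -mul_scalar_mx -[f x *: _]mul_scalar_mx; congr (_ *m _ + _).
apply/matrixP => i j; rewrite derive_entry //; under eq_fun do rewrite mxE.
by rewrite mxE; case: (i == j) => //=; rewrite mulr0n (derive_cst 0).
Qed.

Lemma derive_comm m p q (A : 'rV[R]_m -> 'M[R]_(p, q)) x v w :
  (\forall y \near x, differentiable A y) ->
  differentiable ('D_v A) x -> differentiable ('D_w A) x ->
  'D_w ('D_v A) x = 'D_v ('D_w A) x.
Proof.
move=> dA dv dw; apply/matrixP => i j.
pose a := (fun z => A z i j : R).
have E u : (\near x, 'D_u A x i j = 'D_u a x).
  by apply: filterS dA => y dAy; exact: derive_entry dAy.
apply: etrans (derive_entry w i j dv) _.
apply: etrans (esym (derive_entry v i j dw)).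
apply: etrans (near_eq_derive w (E v)) _.
apply: etrans (esym (near_eq_derive v (E w))).
apply: derive_comm_real.
- by apply: filterS dA => y dAy; exact: (differentiable_entry i j dAy).
- exact: (@near_eq_differentiable _ _ R _ _ _ (E v) (differentiable_entry i j dv)).
- exact: (@near_eq_differentiable _ _ R _ _ _ (E w) (differentiable_entry i j dw)).
Qed.

Lemma jacobianE m n (f : 'rV[R]_m -> 'rV[R]_n) x i k :
  differentiable f x -> 'J f x i k = ('D_(delta_mx 0 i) f x) 0 k.
Proof. by move=> df; rewrite (deriveEjacobian _ df) -rowE [RHS]mxE. Qed.

End MatrixCalculus.

(** * Closure properties of smoothness *)

Section Smoothness.
Context {R : realType}.

Lemma smooth_on_restrict m (W : normedModType R) (U U' : set 'rV[R]_m) (f : 'rV[R]_m -> W) :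
  U' `<=` U -> smooth_on U f -> smooth_on U' f.
Proof. by move=> sU fU s x /sU; exact: fU. Qed.

Lemma smooth_on_differentiable m (W : normedModType R) (U : set 'rV[R]_m)
    (f : 'rV[R]_m -> W) x :
  smooth_on U f -> U x -> differentiable f x.
Proof. by move=> fU; exact: (fU [::]). Qed.

Lemma smooth_on_partial m (W : normedModType R) (U : set 'rV[R]_m)
    (f : 'rV[R]_m -> W) i :
  smooth_on U f -> smooth_on U ('D_(delta_mx 0 i) f).
Proof.
move=> fU s x Ux; have := fU (rcons s i) x Ux.
by rewrite /partials -cats1 foldr_cat.
Qed.

(** A coinduction principle for smoothness: on [U], the iterated partial
    derivatives never leave the class [C], up to pointwise equality. *)
Lemma smooth_on_class m (W : normedModType R) (U : set 'rV[R]_m)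
    (C : ('rV[R]_m -> W) -> Prop) :
  open U ->
  (forall f x, C f -> U x -> differentiable f x) ->
  (forall f i, C f ->
     exists2 g, C g & forall x, U x -> 'D_(delta_mx 0 i) f x = g x) ->
  forall f, C f -> smooth_on U f.
Proof.
move=> oU dC DC f Cf s.
have [g Cg fg] : exists2 g, C g & forall x, U x -> partials s f x = g x.
  elim: s => [|i s [g Cg fg]]; first by exists f.
  have [h Ch gh] := DC g i Cg; exists h => // x Ux.
  rewrite /= -gh //; apply: near_eq_derive.
  by apply: filterS (open_nbhs_nbhs (conj oU Ux)).
move=> x Ux; apply: near_eq_differentiable (dC g x Cg Ux).
by apply: filterS (open_nbhs_nbhs (conj oU Ux)) => y /fg.
Qed.

Lemma smooth_on_ext m (W : normedModType R) (U : set 'rV[R]_m)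
    (f g : 'rV[R]_m -> W) :
  open U -> (forall x, U x -> f x = g x) -> smooth_on U f -> smooth_on U g.
Proof.
move=> oU fg fU.
apply: (@smooth_on_class m W U
  (fun h => exists2 k, smooth_on U k & forall x, U x -> k x = h x)) => //.
- move=> h x [k kU kh] Ux; apply: near_eq_differentiable (kU [::] x Ux).
  by apply: filterS (open_nbhs_nbhs (conj oU Ux)).
- move=> h i [k kU kh]; exists ('D_(delta_mx 0 i) k).
    by exists ('D_(delta_mx 0 i) k) => //; exact: smooth_on_partial.
  move=> x Ux; apply: near_eq_derive.
  by apply: filterS (open_nbhs_nbhs (conj oU Ux)) => y /kh.
- by exists f.
Qed.

Lemma smooth_on_cst m (W : normedModType R) (U : set 'rV[R]_m) (w : W) :
  smooth_on U (cst w : 'rV[R]_m -> W).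
Proof.
have E s : exists w', partials s (cst w : 'rV[R]_m -> W) = cst w'.
  elim: s => [|i s [w' /= ->]]; first by exists w.
  by exists 0; apply/funext => x; rewrite derive_cst.
by move=> s x _; have [w' ->] := E s; exact: differentiable_cst.
Qed.

(** Sums, products, inverses and composites are treated together: differentiating
    one of them produces others, so that it is their common closure which is
    visibly stable under partial derivatives. *)
Inductive smooth_expr m (U : set 'rV[R]_m) : ('rV[R]_m -> R) -> Prop :=
| smooth_expr_base f : @smooth_on R m R^o U f -> smooth_expr U f
| smooth_expr_add f g :
    smooth_expr U f -> smooth_expr U g -> smooth_expr U (fun x => f x + g x)
| smooth_expr_mul f g :
    smooth_expr U f -> smooth_expr U g -> smooth_expr U (fun x => f x * g x)
| smooth_expr_inv f : (forall x, U x -> f x != 0) ->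
    smooth_expr U f -> smooth_expr U (fun x => (f x)^-1)
| smooth_expr_comp n (U' : set 'rV[R]_n) (g : 'rV[R]_n -> R)
    (phi : 'rV[R]_m -> 'rV[R]_n) :
    @smooth_on R n R^o U' g -> (forall x, U x -> U' (phi x)) ->
    (forall k, smooth_expr U (fun x => phi x 0 k)) ->
    smooth_expr U (fun x => g (phi x)).

Lemma smooth_expr_cst m (U : set 'rV[R]_m) (c : R) : smooth_expr U (fun=> c).
Proof. by apply: smooth_expr_base; exact: smooth_on_cst. Qed.

Lemma smooth_expr_sum m (U : set 'rV[R]_m) n (F : 'I_n -> 'rV[R]_m -> R) :
  (forall k, smooth_expr U (F k)) -> smooth_expr U (fun x => \sum_k F k x).
Proof.
move=> FU; rewrite -fct_sumE; elim/big_ind : _ => //.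
  exact: smooth_expr_cst.
by move=> f g; exact: smooth_expr_add.
Qed.

(** The inductive step of [smooth_on_class] for [smooth_expr]: sum, product,
    quotient and chain rule. *)
Lemma smooth_expr_partial m (U : set 'rV[R]_m) (f : 'rV[R]_m -> R) :
  smooth_expr U f ->
  (forall x, U x -> differentiable f x) /\
  (forall i, exists2 g, smooth_expr U g &
     forall x, U x -> 'D_(delta_mx 0 i) f x = g x).
Proof.
elim=> {f}.
- move=> f fU; split=> [x Ux|i]; first exact: (fU [::] x Ux).
  exists ('D_(delta_mx 0 i) f) => //.
  by apply: smooth_expr_base; exact: smooth_on_partial.
- move=> f g fU [df Df] gU [dg Dg]; split=> [x Ux|i].
    exact: (differentiableD (df x Ux) (dg x Ux)).
  have [f' f'U Ef] := Df i; have [g' g'U Eg] := Dg i.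
  exists (fun x => f' x + g' x); first exact: smooth_expr_add.
  move=> x Ux; rewrite -Ef // -Eg //.
  by apply: deriveD; apply: diff_derivable; [exact: df|exact: dg].
- move=> f g fU [df Df] gU [dg Dg]; split=> [x Ux|i].
    exact: (differentiableM (df x Ux) (dg x Ux)).
  have [f' f'U Ef] := Df i; have [g' g'U Eg] := Dg i.
  exists (fun x => f x * g' x + g x * f' x).
    by apply: smooth_expr_add; exact: smooth_expr_mul.
  move=> x Ux; rewrite -Ef // -Eg //.
  by apply: deriveM; apply: diff_derivable; [exact: df|exact: dg].
- move=> f f0 fU [df Df]; split=> [x Ux|i].
    exact: differentiableV (df x Ux) (f0 x Ux).
  have [f' f'U Ef] := Df i.
  exists (fun x => (-1) * ((f x)^-1 * (f x)^-1) * f' x).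
    by do !apply: smooth_expr_mul => //;
      [exact: smooth_expr_cst|exact: smooth_expr_inv|exact: smooth_expr_inv].
  move=> x Ux; rewrite -Ef // mulN1r -invfM -expr2.
  by apply: deriveV; [exact: f0|apply: diff_derivable; exact: df].
- move=> n U' g phi gU' UU' phiU dphi.
  have dphi' x : U x -> differentiable phi x.
    by move=> Ux; apply: differentiable_mx => i k; rewrite ord1; exact: ((dphi k).1 x Ux).
  split=> [x Ux|i].
    by apply: differentiable_comp (dphi' x Ux) (gU' [::] _ (UU' _ Ux)).
  have /choice[D DE] k : exists g, smooth_expr U g /\
      forall x, U x -> 'D_(delta_mx 0 i) (fun x => phi x 0 k) x = g x.
    by have [h] := (dphi k).2 i; exists h.
  exists (fun x => \sum_k D k x * 'D_(delta_mx 0 k) g (phi x)).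
    apply: smooth_expr_sum => k; apply: smooth_expr_mul; first exact: (DE k).1.
    exact: (smooth_expr_comp (smooth_on_partial k gU') UU' phiU).
  move=> x Ux; rewrite (derive_comp_lincomb _ (dphi' x Ux) (gU' [::] _ (UU' _ Ux))).
  apply: eq_bigr => k _; congr (_ * _).
  by rewrite -(DE k).2 // -derive_entry //; exact: dphi'.
Qed.

Lemma smooth_expr_smooth m (U : set 'rV[R]_m) (f : 'rV[R]_m -> R) :
  open U -> smooth_expr U f -> @smooth_on R m R^o U f.
Proof.
move=> oU; apply: (@smooth_on_class m R^o U (smooth_expr U)) => //.
- by move=> g x Cg Ux; exact: (smooth_expr_partial Cg).1 x Ux.
- by move=> g i Cg; exact: (smooth_expr_partial Cg).2.
Qed.

(** Entrywise smoothness, which lets matrix-valued functions use the scalar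
    class [smooth_expr]. *)
Definition smooth_entries m p q (U : set 'rV[R]_m) (A : 'rV[R]_m -> 'M[R]_(p, q)) :=
  forall i j, smooth_expr U (fun x => A x i j).

Lemma smooth_on_entries m p q (U : set 'rV[R]_m) (A : 'rV[R]_m -> 'M[R]_(p, q)) :
  open U -> smooth_on U A <-> smooth_entries U A.
Proof.
move=> oU; split=> [AU i j|AU].
  apply: smooth_expr_base.
  apply: (@smooth_on_class m R^o U (fun f =>
    exists2 B : 'rV[R]_m -> 'M[R]_(p, q), smooth_on U B &
      f = (fun x => B x i j))) => //; last by exists A.
  - move=> _ x [B BU ->] Ux.
    by refine (differentiable_entry i j (BU [::] x Ux)).
  - move=> _ k [B BU ->].
    exists (fun x => 'D_(delta_mx 0 k) B x i j).
      by exists ('D_(delta_mx 0 k) B) => //; exact: smooth_on_partial.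
    by move=> x Ux; apply/esym/(derive_entry _ i j (BU [::] x Ux)).
apply: (@smooth_on_class m _ U (@smooth_entries m p q U)) => //.
- move=> B x BU Ux; apply: differentiable_mx => i j.
  exact: (smooth_expr_partial (BU i j)).1 x Ux.
- move=> B k BU.
  have dB x : U x -> differentiable B x.
    by move=> Ux; apply: differentiable_mx => i j;
       exact: (smooth_expr_partial (BU i j)).1 x Ux.
  have /choice[D DE] (ij : 'I_p * 'I_q) : exists g, smooth_expr U g /\
      forall x, U x -> 'D_(delta_mx 0 k) (fun x => B x ij.1 ij.2) x = g x.
    by have [h] := (smooth_expr_partial (BU ij.1 ij.2)).2 k; exists h.
  exists (fun x => \matrix_(i, j) D (i, j) x).
    move=> i j; have -> : (fun x => (\matrix_(i, j) D (i, j) x) i j) = D (i, j).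
      by apply/funext => x; rewrite mxE.
    exact: (DE (i, j)).1.
  move=> x Ux; apply/matrixP => i j; rewrite mxE (derive_entry _ i j (dB x Ux)).
  exact: (DE (i, j)).2.
Qed.

End Smoothness.

Section SmoothMatrices.
Context {R : realType}.

Section OneDomain.
Variables (m : nat) (U : set 'rV[R]_m).
Hypothesis oU : open U.

Lemma smooth_on_mulmx p q r (A : 'rV[R]_m -> 'M[R]_(p, q)) (B : 'rV[R]_m -> 'M[R]_(q, r)) :
  smooth_on U A -> smooth_on U B -> smooth_on U (fun x => A x *m B x).
Proof.
rewrite !smooth_on_entries // => AU BU i j; under eq_fun do rewrite mxE.
by apply: smooth_expr_sum => k; exact: smooth_expr_mul.
Qed.

Lemma smooth_on_add p q (A B : 'rV[R]_m -> 'M[R]_(p, q)) :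
  smooth_on U A -> smooth_on U B -> smooth_on U (fun x => A x + B x).
Proof.
rewrite !smooth_on_entries // => AU BU i j; under eq_fun do rewrite mxE.
exact: smooth_expr_add.
Qed.

Lemma smooth_on_scale p q (f : 'rV[R]_m -> R) (A : 'rV[R]_m -> 'M[R]_(p, q)) :
  @smooth_on R m R^o U f -> smooth_on U A -> smooth_on U (fun x => f x *: A x).
Proof.
move=> fU; rewrite !smooth_on_entries // => AU i j; under eq_fun do rewrite mxE.
by apply: smooth_expr_mul => //; exact: smooth_expr_base.
Qed.

Lemma smooth_on_opp p q (A : 'rV[R]_m -> 'M[R]_(p, q)) :
  smooth_on U A -> smooth_on U (fun x => - A x).
Proof.
move=> AU; have := smooth_on_scale (@smooth_on_cst _ m R^o U (-1)) AU.
by under eq_fun do rewrite scaleN1r.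
Qed.

Lemma smooth_on_subr p q (A B : 'rV[R]_m -> 'M[R]_(p, q)) :
  smooth_on U A -> smooth_on U B -> smooth_on U (fun x => A x - B x).
Proof. by move=> AU BU; apply: smooth_on_add => //; exact: smooth_on_opp. Qed.

Lemma smooth_on_sum p q n (A : 'I_n -> 'rV[R]_m -> 'M[R]_(p, q)) :
  (forall k, smooth_on U (A k)) -> smooth_on U (fun x => \sum_k A k x).
Proof.
move=> AU; rewrite -fct_sumE; elim/big_ind : _ => //.
  exact: smooth_on_cst.
by move=> f g; exact: smooth_on_add.
Qed.

Lemma smooth_on_trmx p q (A : 'rV[R]_m -> 'M[R]_(p, q)) :
  smooth_on U A -> smooth_on U (fun x => (A x)^T).
Proof.
by rewrite !smooth_on_entries // => AU i j; under eq_fun do rewrite mxE.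
Qed.

Lemma smooth_on_matrix p q (F : 'I_p -> 'I_q -> 'rV[R]_m -> R) :
  (forall i j, @smooth_on R m R^o U (F i j)) ->
  smooth_on U (fun x => \matrix_(i, j) F i j x).
Proof.
move=> FU; apply/smooth_on_entries => // i j; under eq_fun do rewrite mxE.
exact: smooth_expr_base.
Qed.

Lemma smooth_on_entry p q (A : 'rV[R]_m -> 'M[R]_(p, q)) i j :
  smooth_on U A -> @smooth_on R m R^o U (fun x => A x i j).
Proof. by move=> /(smooth_on_entries A oU) AU; exact: smooth_expr_smooth. Qed.

Lemma smooth_on_row p q (A : 'rV[R]_m -> 'M[R]_(p, q)) i :
  smooth_on U A -> smooth_on U (fun x => row i (A x)).
Proof.
by rewrite !smooth_on_entries // => AU k j; under eq_fun do rewrite mxE.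
Qed.

Lemma smooth_expr_prod n (F : 'I_n -> 'rV[R]_m -> R) :
  (forall k, smooth_expr U (F k)) -> smooth_expr U (fun x => \prod_k F k x).
Proof.
move=> FU; rewrite -fct_prodE; elim/big_ind : _ => //.
  exact: smooth_expr_cst.
by move=> f g; exact: smooth_expr_mul.
Qed.

Lemma smooth_expr_det p (A : 'rV[R]_m -> 'M[R]_p) :
  smooth_entries U A -> smooth_expr U (fun x => \det (A x)).
Proof.
move=> AU; rewrite /determinant -fct_sumE; elim/big_ind : _ => [|f g|s _].
- exact: smooth_expr_cst.
- exact: smooth_expr_add.
- apply: smooth_expr_mul; first exact: smooth_expr_cst.
  by apply: smooth_expr_prod => i; exact: AU.
Qed.

Lemma smooth_on_invmx p (A : 'rV[R]_m -> 'M[R]_p) :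
  (forall x, U x -> A x \in unitmx) ->
  smooth_on U A -> smooth_on U (fun x => invmx (A x)).
Proof.
move=> uA AU.
apply: (@smooth_on_ext _ m _ U (fun x => (\det (A x))^-1 *: \adj (A x))) => //.
  by move=> x Ux; rewrite /invmx uA.
move/smooth_on_entries : (AU) => /(_ oU) AE.
apply: smooth_on_scale.
  apply: smooth_expr_smooth => //; apply: smooth_expr_inv.
    by move=> x Ux; have := uA x Ux; rewrite unitmxE unitfE.
  exact: smooth_expr_det.
apply/smooth_on_entries => // i j; under eq_fun do rewrite mxE /cofactor.
apply: smooth_expr_mul; first exact: smooth_expr_cst.
by apply: smooth_expr_det => k l; under eq_fun do rewrite !mxE.
Qed.

Lemma smooth_on_comp n (U' : set 'rV[R]_n) p q (A : 'rV[R]_n -> 'M[R]_(p, q))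
    (phi : 'rV[R]_m -> 'rV[R]_n) :
  open U' -> smooth_on U phi -> (forall x, U x -> U' (phi x)) ->
  smooth_on U' A -> smooth_on U (fun x => A (phi x)).
Proof.
move=> oU' /(smooth_on_entries phi oU) phiU UU' AU'.
apply/smooth_on_entries => // i j.
have Aij : @smooth_on R n R^o U' (fun y => A y i j).
  by apply: smooth_expr_smooth => //; move/smooth_on_entries : AU'; exact.
exact: (smooth_expr_comp Aij UU' (phiU 0)).
Qed.

Lemma smooth_on_comp_real n (U' : set 'rV[R]_n) (f : 'rV[R]_n -> R)
    (phi : 'rV[R]_m -> 'rV[R]_n) :
  smooth_on U phi -> (forall x, U x -> U' (phi x)) ->
  @smooth_on R n R^o U' f -> @smooth_on R m R^o U (fun x => f (phi x)).
Proof.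
move=> /(smooth_on_entries phi oU) phiU UU' fU'.
by apply: smooth_expr_smooth => //; exact: (smooth_expr_comp fU' UU' (phiU 0)).
Qed.

Lemma smooth_on_jacobian n (phi : 'rV[R]_m -> 'rV[R]_n) :
  smooth_on U phi -> smooth_on U (fun x => 'J phi x).
Proof.
move=> phiU.
apply: (@smooth_on_ext _ m _ U (fun x => \matrix_(i, k) 'D_(delta_mx 0 i) phi x 0 k)) => //.
  by move=> x Ux; apply/matrixP => i k; rewrite mxE (jacobianE _ _ (phiU [::] x Ux)).
by apply: smooth_on_matrix => i j; apply: smooth_on_entry; exact: smooth_on_partial.
Qed.

End OneDomain.
End SmoothMatrices.

(** * Christoffel symbols as matrices, and their conformal change *)

Section Christoffel.
Context {R : realType} {n : nat}.
Implicit Types (G : 'rV[R]_n -> 'M[R]_n) (x : 'rV[R]_n) (i j k l : 'I_n).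
Local Notation e := (@delta_mx R 1 n 0).

(** Twice the Christoffel symbols of the first kind, from the family [D] of first
    derivatives of the metric.  Keeping the derivatives abstract makes the next
    two identities purely algebraic. *)
Definition koszul (D : 'I_n -> 'M[R]_n) i : 'M[R]_n :=
  \matrix_(j, l) (D i j l + D j i l - D l i j).

(** Apart from the symmetric term [D i], the Koszul expression is antisymmetric
    in [j] and [l]. *)
Lemma symmetrized_koszul (D : 'I_n -> 'M[R]_n) i : (forall k, (D k)^T = D k) ->
  2^-1 *: koszul D i + (2^-1 *: koszul D i)^T = D i.
Proof.
move=> Ds; apply/matrixP => j l.
have Dsy k j' l' : D k j' l' = D k l' j' by rewrite -{1}Ds mxE.
by rewrite !mxE (Dsy i l j); field.
Qed.

Lemma koszul_conformal (D : 'I_n -> 'M[R]_n) (G : 'M[R]_n) (a : R) (t : 'rV[R]_n) i :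
  koszul (fun k => a *: ((2 * t 0 k) *: G + D k)) i
  = a *: (koszul D i + 2 *: (t 0 i *: G + t^T *m row i G - (row i G)^T *m t)).
Proof. by apply/matrixP => j l; rewrite !(mxE, big_ord1); ring. Qed.

Definition first_partials G x i : 'M[R]_n := 'D_(e i) G x.

(** The matrix of the linear map [a |-> nabla_(e_i) a - D_(e_i) a] acting on row
    vectors. *)
Definition christoffel_mx G i x : 'M[R]_n :=
  2^-1 *: (koszul (first_partials G x) i *m (invmx (G x))^T).

Lemma christoffelE G x v w :
  christoffel G x v w = \sum_i v 0 i *: (w *m christoffel_mx G i x).
Proof.
apply/rowP => k; rewrite mxE summxE mulr_sumr; apply: eq_bigr => i _.
rewrite [RHS]mxE [X in _ = _ * X]mxE !mulr_sumr.
apply: eq_bigr => j _.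
have -> : christoffel_mx G i x j k
    = 2^-1 * \sum_l koszul (first_partials G x) i j l * invmx (G x) k l.
  by rewrite mxE mxE; congr (_ * _); apply: eq_bigr => l _; rewrite [X in _ * X]mxE.
rewrite !mulr_sumr; apply: eq_bigr => l _.
by rewrite [koszul (first_partials G x) i j l]mxE /first_partials; ring.
Qed.

Lemma derive_symmetric (V : normedModType R) p (A : V -> 'M[R]_p) y v :
  (\near y, (A y)^T = A y) -> differentiable A y -> ('D_v A y)^T = 'D_v A y.
Proof.
move=> As dA; rewrite -derive_trmx //; exact: near_eq_derive As.
Qed.

(** The Levi-Civita connection is metric: [christoffel_mx G i x *m G x] is half
    the Koszul expression, whose symmetrization is the derivative of [G]. *)
Lemma christoffel_mx_compat G i x :
  (\near x, (G x)^T = G x) -> differentiable G x -> G x \in unitmx ->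
  christoffel_mx G i x *m G x + G x *m (christoffel_mx G i x)^T = 'D_(e i) G x.
Proof.
move=> Gs dG Gu; have Gx : (G x)^T = G x := nbhs_singleton Gs.
have E : christoffel_mx G i x *m G x = 2^-1 *: koszul (first_partials G x) i.
  by rewrite /christoffel_mx -scalemxAl trmx_inv Gx mulmxKV.
have -> : G x *m (christoffel_mx G i x)^T = (2^-1 *: koszul (first_partials G x) i)^T.
  by rewrite -E trmx_mul Gx.
rewrite E; apply: symmetrized_koszul => k.
exact: derive_symmetric Gs dG.
Qed.

(** The Levi-Civita connection is torsion-free. *)
Lemma christoffel_mx_sym G i j k x :
  (\near x, (G x)^T = G x) -> differentiable G x ->
  christoffel_mx G i x j k = christoffel_mx G j x i k.
Proof.
move=> Gs dG; rewrite !mxE; congr (_ * _); apply: eq_bigr => l _.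
rewrite !mxE [_ + first_partials G x j i l]addrC.
have Ds : (first_partials G x l)^T = first_partials G x l := derive_symmetric (e l) Gs dG.
by rewrite -{1}Ds mxE.
Qed.

Lemma smooth_on_christoffel_mx (U : set 'rV[R]_n) G i :
  open U -> (forall x, U x -> G x \in unitmx) -> smooth_on U G ->
  smooth_on U (christoffel_mx G i).
Proof.
move=> oU uG GU.
apply: smooth_on_scale => //; first exact: smooth_on_cst.
apply: smooth_on_mulmx => //; last first.
  by apply: smooth_on_trmx => //; exact: smooth_on_invmx.
apply: smooth_on_matrix => // j l.
have DG k j' l' : smooth_expr U (fun x => 'D_(e k) G x j' l').
  by apply: smooth_expr_base; exact: (smooth_on_entry oU j' l' (smooth_on_partial k GU)).
apply: smooth_expr_smooth => //.
apply: smooth_expr_add; first exact: (smooth_expr_add (DG i j l) (DG j i l)).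
under eq_fun do rewrite -mulN1r.
exact: (smooth_expr_mul (smooth_expr_cst U (-1)) (DG l i j)).
Qed.

(** The differential of [c], as a row of components. *)
Definition grad (c : 'rV[R]_n -> R) x : 'rV[R]_n := \row_k 'D_(e k) c x.

Lemma derive_expR2 (c : 'rV[R]_n -> R) x v : differentiable c x ->
  differentiable (fun y => expR (2 * c y)) x /\
  'D_v (fun y => expR (2 * c y)) x = expR (2 * c x) * (2 * 'D_v c x).
Proof.
move=> dc.
have d2c : differentiable (fun y => 2 * c y) x by exact: differentiableZ.
have de : differentiable (expR : R -> R) (2 * c x) by apply/derivable1_diffP.
have d : differentiable (fun y => expR (2 * c y)) x.
  exact: (differentiable_comp d2c de).
split=> //; rewrite deriveE // (diff_comp d2c de) /= -(deriveE v d2c).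
have dexp h : 'd expR (2 * c x) h = h * expR (2 * c x).
  have <- : 'D_1 expR (2 * c x) = expR (2 * c x) by rewrite -[in RHS]derive_expR.
  by rewrite (deriveE (1 : R) de) -{1}[h]mulr1; exact: linearZ.
rewrite dexp mulrC; congr (_ * _).
by apply: deriveZ; exact: diff_derivable.
Qed.

(** In terms of vectors, this is the classical
    [nabla'_X Y = nabla_X Y + dc(X) Y + dc(Y) X - g(X, Y) grad c] for the metric
    [e^(2c) g]. *)
Lemma christoffel_mx_conformal G (c : 'rV[R]_n -> R) i x :
  (G x)^T = G x -> differentiable G x -> G x \in unitmx -> differentiable c x ->
  christoffel_mx (fun y => expR (2 * c y) *: G y) i x
  = christoffel_mx G i x + ('D_(e i) c x)%:M + (grad c x)^T *m e i
    - (row i (G x))^T *m (grad c x *m invmx (G x)).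
Proof.
move=> Gs dG Gu dc; set E := expR (2 * c x).
have E0 : E != 0 by rewrite gt_eqF // expR_gt0.
have DE : first_partials (fun y => expR (2 * c y) *: G y) x
    = (fun k => E *: ((2 * grad c x 0 k) *: G x + first_partials G x k)).
  apply/funext => k; have [d De] := derive_expR2 (e k) dc.
  by rewrite /first_partials derive_scalemx // De mxE scalerDr scalerA.
have K := koszul_conformal (first_partials G x) (G x) E (grad c x) i.
rewrite -DE mxE in K.
have iGs : (invmx (G x))^T = invmx (G x) by rewrite trmx_inv Gs.
rewrite /christoffel_mx K invmxZ; last by rewrite unitmxZ ?unitfE.
have EE (X Y : 'M[R]_n) : (E *: X) *m (E^-1 *: Y) = X *m Y.
  by rewrite -scalemxAl -scalemxAr scalerA mulfV // scale1r.
rewrite [(_ *: invmx _)^T]linearZ /= iGs EE.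
rewrite mulmxDl scalerDr -!addrA; congr (_ + _).
rewrite -scalemxAl scalerA mulVf ?pnatr_eq0 // scale1r !mulmxDl mulNmx.
rewrite -scalemxAl mulmxV // scalemx1 -!mulmxA; congr (_ + (_ *m _ + _)).
by rewrite rowE -mulmxA mulmxV // mulmx1.
Qed.

(** Flatness tested on the coordinate fields, whose brackets vanish. *)
Lemma flat_christoffel_mx (U : set 'rV[R]_n) G :
  (forall i x, U x -> differentiable (christoffel_mx G i) x) -> flat_on U G ->
  forall x, U x -> forall i j,
    'D_(e i) (christoffel_mx G j) x - 'D_(e j) (christoffel_mx G i) x
    + christoffel_mx G j x *m christoffel_mx G i x
    - christoffel_mx G i x *m christoffel_mx G j x = 0.
Proof.
move=> dC flG x Ux i j.
have Jid y (v : 'rV[R]_n) : v *m 'J (id : 'rV[R]_n -> 'rV[R]_n) y = v.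
  have di : differentiable (id : 'rV[R]_n -> 'rV[R]_n) y by [].
  by rewrite -[RHS](derive_id y v) (deriveEjacobian v di).
have covE k (N : 'rV[R]_n -> 'rV[R]_n) y :
    cov G id (cst (e k)) N y = 'D_(e k) N y + N y *m christoffel_mx G k y.
  rewrite /cov christoffelE Jid (bigD1 k) //= big1 => [|l lk].
    by rewrite mxE !eqxx scale1r addr0.
  by rewrite mxE (negbTE lk) andbF scale0r.
(* The [m]-th row is the curvature applied to the [m]-th coordinate field. *)
apply/row_matrixP => m; rewrite row0 rowE.
have := flG _ _ _ (@smooth_on_cst _ _ _ U (e i)) (@smooth_on_cst _ _ _ U (e j))
  (@smooth_on_cst _ _ _ U (e m)) x Ux.
rewrite /curvature.
have cov2 k l : cov G id (cst (e k)) (cov G id (cst (e l)) (cst (e m))) x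
  = e m *m ('D_(e k) (christoffel_mx G l) x + christoffel_mx G l x *m christoffel_mx G k x).
  rewrite covE.
  have -> : cov G id (cst (e l)) (cst (e m)) = (fun y => e m *m christoffel_mx G l y).
    by apply/funext => y; rewrite covE derive_cst add0r.
  have dz : differentiable (cst (e m) : 'rV[R]_n -> 'rV[R]_n) x by exact: differentiable_cst.
  have /= -> := derive_mulmx (e k) dz (dC l x Ux).
  by rewrite derive_cst mul0mx add0r mulmxDr mulmxA.
have -> : cov G id (bracket (cst (e i)) (cst (e j))) (cst (e m)) x = 0.
  rewrite /cov christoffelE Jid /bracket !derive_cst subr0 add0r big1 // => k _.
  by rewrite mxE scale0r.
rewrite !cov2 subr0 -mulmxBr => H; rewrite -[RHS]H; congr (_ *m _).
by rewrite opprD !addrA; congr (_ - _); rewrite addrAC.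
Qed.

End Christoffel.

(** * Coplanarity of symmetric two-by-two matrices *)

Section TwoByTwo.
Context {R : realType}.

Lemma sum_ord2 (V : nmodType) (F : 'I_2 -> V) : \sum_i F i = F 0 + F 1.
Proof. by rewrite big_ord_recl big_ord1; congr (_ + F _); exact: val_inj. Qed.

Lemma ord2P (i : 'I_2) : i = 0 \/ i = 1.
Proof. by case: i => -[|[|//]] ?; [left|right]; exact: val_inj. Qed.

Lemma mulmx2E p q (A : 'M[R]_(p, 2)) (B : 'M[R]_(2, q)) i j :
  (A *m B) i j = A i 0 * B 0 j + A i 1 * B 1 j.
Proof. by rewrite mxE sum_ord2. Qed.

(** The determinant of a symmetric [h]. *)
Definition symdet (h : 'M[R]_2) : R := h 0 0 * h 1 1 - h 0 1 ^+ 2.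

(** Sylvester's criterion; the determinant is reached by evaluating the form at
    [(h 0 1, - h 0 0)]. *)
Lemma positive_definite_symdet (h : 'M[R]_2) : h^T = h -> positive_definite h ->
  0 < h 0 0 /\ 0 < symdet h.
Proof.
move=> hs hpos; have h10 : h 1 0 = h 0 1 by rewrite -{1}hs mxE.
pose v (x y : R) : 'rV[R]_2 := \row_i (if i == 0 then x else y).
have E x y : ip h (v x y) (v x y) = x ^+ 2 * h 0 0 + 2 * (x * y * h 0 1) + y ^+ 2 * h 1 1.
  by rewrite /ip !mulmx2E !mxE /= h10; ring.
have h00 : 0 < h 0 0.
  have /hpos : v 1 0 != 0.
    by apply/eqP => /rowP /(_ 0); rewrite !mxE /= => /eqP; rewrite oner_eq0.
  by rewrite E; congr (0 < _); ring.
split=> //; have /hpos : v (h 0 1) (- h 0 0) != 0.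
  apply/eqP => /rowP /(_ 1); rewrite !mxE /= => /eqP.
  by rewrite oppr_eq0 gt_eqF.
rewrite E (_ : _ + _ = h 0 0 * symdet h); last by rewrite /symdet; ring.
by rewrite pmulr_rgt0.
Qed.

Definition adj2 (h : 'M[R]_2) : 'M[R]_2 := \matrix_(i, j)
  (if i == j then h (1 - i) (1 - i) else - h 0 1).

Lemma invmx2 (h : 'M[R]_2) : h^T = h -> symdet h != 0 ->
  h \in unitmx /\ invmx h = (symdet h)^-1 *: adj2 h.
Proof.
move=> hs d0; have h10 : h 1 0 = h 0 1 by rewrite -{1}hs mxE.
have E : h *m ((symdet h)^-1 *: adj2 h) = 1%:M.
  rewrite -scalemxAr; apply/matrixP => i j; rewrite !mxE sum_ord2 !mxE.
  have s0 : 1 - 0 = 1 :> 'I_2 by exact: val_inj.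
  have s1 : 1 - 1 = 0 :> 'I_2 by exact: val_inj.
  by case: (ord2P i) => ->; case: (ord2P j) => -> /=; rewrite ?s0 ?s1 ?h10;
    move: d0; rewrite /symdet => d0; field.
have [hU _] := mulmx1_unit E; split=> //.
by rewrite -[LHS]mulmx1 -E mulKmx.
Qed.

(** Symmetric matrices of size two form a three-dimensional space; this is the
    determinant of [B], [h], [B'] there, in the coordinates of indices [(0, 0)],
    [(0, 1)] and [(1, 1)].  It vanishes when the three matrices are coplanar. *)
Definition triple (B h B' : 'M[R]_2) : R :=
  B 0 0 * (h 0 1 * B' 1 1 - h 1 1 * B' 0 1)
  - B 0 1 * (h 0 0 * B' 1 1 - h 1 1 * B' 0 0)
  + B 1 1 * (h 0 0 * B' 0 1 - h 0 1 * B' 0 0).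

(** Why coplanarity governs the Ricci equation: the antisymmetric part of
    [B h^-1 B'], that is, the commutator of the endomorphisms [B h^-1] and
    [B' h^-1], has a single entry, and it is a triple product. *)
Lemma triple_commutator (B h B' : 'M[R]_2) :
  B^T = B -> h^T = h -> B'^T = B' -> symdet h != 0 ->
  let K := B *m invmx h *m B' in K 1 0 - K 0 1 = triple B h B' / symdet h.
Proof.
move=> Bs hs Bs' d0 K; rewrite /K; have [_ ->] := invmx2 hs d0.
have B10 : B 1 0 = B 0 1 by rewrite -{1}Bs mxE.
have B10' : B' 1 0 = B' 0 1 by rewrite -{1}Bs' mxE.
have h10 : h 1 0 = h 0 1 by rewrite -{1}hs mxE.
have s0 : 1 - 0 = 1 :> 'I_2 by exact: val_inj.
have s1 : 1 - 1 = 0 :> 'I_2 by exact: val_inj.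
rewrite !mulmx2E !mxE /= s0 s1 B10 B10'.
by rewrite /triple; ring.
Qed.

Lemma symmx2P (B B' : 'M[R]_2) : B^T = B -> B'^T = B' ->
  B 0 0 = B' 0 0 -> B 0 1 = B' 0 1 -> B 1 1 = B' 1 1 -> B = B'.
Proof.
move=> Bs Bs' H00 H01 H11.
have B10 : B 1 0 = B 0 1 by rewrite -{1}Bs mxE.
have B10' : B' 1 0 = B' 0 1 by rewrite -{1}Bs' mxE.
apply/matrixP => i j.
by case: (ord2P i) => ->; case: (ord2P j) => ->; rewrite // B10 B10'.
Qed.

(** The relation can be taken with [(x, y) != (0, 0)] because [h] is not zero.
    Subtracting multiples of [h] kills the entries [(0, 0)] of [B] and [B'] up to
    the factor [h 0 0]; the remaining entries, [beta] and [gamma], form a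
    two-by-two system whose determinant is [h 0 0 * triple B h B'] up to
    sign. *)
Lemma triple0_dependent (B h B' : 'M[R]_2) :
  B^T = B -> h^T = h -> B'^T = B' -> h 0 0 != 0 -> triple B h B' = 0 ->
  exists x y z : R, (x != 0) || (y != 0) /\ x *: B + y *: B' = z *: h.
Proof.
move=> Bs hs Bs' h0 T.
pose beta (C : 'M[R]_2) := h 0 0 * C 0 1 - C 0 0 * h 0 1 : R.
pose gamma (C : 'M[R]_2) := h 0 0 * C 1 1 - C 0 0 * h 1 1 : R.
have build (x y : R) : (x != 0) || (y != 0) ->
    x * beta B + y * beta B' = 0 -> x * gamma B + y * gamma B' = 0 ->
    exists x y z : R, (x != 0) || (y != 0) /\ x *: B + y *: B' = z *: h.
  move=> xy0 bb gg; exists x, y, ((x * B 0 0 + y * B' 0 0) / h 0 0); split=> //.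
  have sym (a b : R) (C D : 'M[R]_2) : C^T = C -> D^T = D ->
      (a *: C + b *: D)^T = a *: C + b *: D.
    by move=> Cs Ds; rewrite [LHS]raddfD /= [(a *: _)^T]linearZ [(b *: _)^T]linearZ /= Cs Ds.
  apply: symmx2P; first exact: sym.
  - by rewrite [LHS]linearZ /= hs.
  - by rewrite !mxE; field.
  - rewrite !mxE; apply: (mulfI h0); apply/eqP; rewrite -subr_eq0 -[X in _ == X]bb.
    by rewrite /beta; apply/eqP; field.
  - rewrite !mxE; apply: (mulfI h0); apply/eqP; rewrite -subr_eq0 -[X in _ == X]gg.
    by rewrite /gamma; apply/eqP; field.
have hT : beta B' * gamma B - beta B * gamma B' = 0.
  rewrite -[RHS](mulr0 (h 0 0)) -T /triple /beta /gamma; ring.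
move: (beta B) (beta B') (gamma B) (gamma B') build hT => b b' c c' build hT.
have [b0|b0] := boolP ((b' != 0) || (- b != 0)).
  by apply: (build _ _ b0); [ring|rewrite mulNr].
move: b0; rewrite negb_or !negbK oppr_eq0 => /andP[/eqP b1 /eqP b2].
have [c0|c0] := boolP ((c' != 0) || (- c != 0)).
  by apply: (build _ _ c0); [rewrite b1 b2 !mulr0 addr0|rewrite mulNr mulrC subrr].
move: c0; rewrite negb_or !negbK oppr_eq0 => /andP[/eqP c1 /eqP c2].
apply: (build 1 0); first by rewrite oner_eq0.
  by rewrite b2 mulr0 mul0r addr0.
by rewrite c2 mulr0 mul0r addr0.
Qed.

(** The determinant is linear in [B] and in [B'], so that the relation can be
    substituted for whichever of them has a nonzero coefficient. *)
Lemma dependent_triple0 (B h B' : 'M[R]_2) (x y z : R) :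
  (x != 0) || (y != 0) -> x *: B + y *: B' = z *: h -> triple B h B' = 0.
Proof.
move=> xy E.
have Eij i j : x * B i j + y * B' i j = z * h i j.
  by move/matrixP : E => /(_ i j); rewrite !mxE.
case/orP: xy => n0; apply: (mulfI n0); rewrite mulr0 /triple.
  transitivity ((x * B 0 0) * (h 0 1 * B' 1 1 - h 1 1 * B' 0 1)
    - (x * B 0 1) * (h 0 0 * B' 1 1 - h 1 1 * B' 0 0)
    + (x * B 1 1) * (h 0 0 * B' 0 1 - h 0 1 * B' 0 0)); first by ring.
  have xE i j : x * B i j = z * h i j - y * B' i j by rewrite -Eij addrK.
  by rewrite !xE; ring.
transitivity (B 0 0 * (h 0 1 * (y * B' 1 1) - h 1 1 * (y * B' 0 1))
    - B 0 1 * (h 0 0 * (y * B' 1 1) - h 1 1 * (y * B' 0 0))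
    + B 1 1 * (h 0 0 * (y * B' 0 1) - h 0 1 * (y * B' 0 0))); first by ring.
have yE i j : y * B' i j = z * h i j - x * B i j by rewrite -Eij addrC addKr.
by rewrite !yE; ring.
Qed.

(** The vectors lie in the kernel of [K], which is a plane. *)
Lemma three_dependent (K : 'M[R]_(4, 2)) (a b c : 'rV[R]_4) :
  \rank K = 2%N -> a *m K = 0 -> b *m K = 0 -> c *m K = 0 ->
  exists x y z : R, [|| x != 0, y != 0 | z != 0] /\ x *: a + y *: b + z *: c = 0.
Proof.
move=> rK aK bK cK.
pose A : 'M[R]_(1 + (1 + 1), 4) := col_mx a (col_mx b c).
have AK : A *m K = 0 by rewrite !mul_col_mx aK bK cK !col_mx0.
have : kermx A != 0.
  rewrite kermx_eq0 /row_free; apply: contraTneq (mulmx0_rank_max AK) => ->.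
  by rewrite rK.
case/rowV0Pn => v /sub_kermxP vA v0.
exists (lsubmx v 0 0), (lsubmx (rsubmx v) 0 0), (rsubmx (rsubmx v) 0 0).
have : lsubmx v *m a + (lsubmx (rsubmx v) *m b + rsubmx (rsubmx v) *m c) = 0.
  by rewrite -[RHS]vA -[v in RHS]hsubmxK -[rsubmx v in RHS]hsubmxK !mul_row_col.
have V : v = row_mx (lsubmx v) (row_mx (lsubmx (rsubmx v)) (rsubmx (rsubmx v))).
  by rewrite !hsubmxK.
move: (lsubmx v) (lsubmx (rsubmx v)) (rsubmx (rsubmx v)) V => x y z V E.
split; last first.
  by rewrite -!mul_scalar_mx -!mx11_scalar -addrA.
apply: contraR v0; rewrite !negb_or !negbK => /and3P[/eqP x0 /eqP y0 /eqP z0].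
by rewrite V [x]mx11_scalar [y]mx11_scalar [z]mx11_scalar x0 y0 z0 !raddf0 !row_mx0.
Qed.

Lemma plane_basis (K : 'M[R]_(4, 2)) : \rank K = 2%N ->
  exists a b : 'rV[R]_4, [/\ a *m K = 0, b *m K = 0 &
    forall x y : R, x *: a + y *: b = 0 -> x = 0 /\ y = 0].
Proof.
move=> rK.
have [C [CK Cf]] : exists C : 'M[R]_(2, 4), C *m K = 0 /\ row_free C.
  have r2 : \rank (kermx K) = 2%N by rewrite mxrank_ker rK.
  have BK : row_base (kermx K) *m K = 0.
    by apply/sub_kermxP; rewrite eq_row_base.
  have cast k (B : 'M[R]_(k, 4)) : k = 2%N -> row_free B -> B *m K = 0 ->
      exists C : 'M[R]_(2, 4), C *m K = 0 /\ row_free C.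
    by move=> k2; subst k => Bf B0; exists B.
  exact: cast r2 (row_base_free _) BK.
exists (row 0 C), (row 1 C); split; rewrite -?row_mul ?CK ?row0 //.
move=> x y E.
pose v : 'rV[R]_2 := \row_i (if i == 0 then x else y).
have : v *m C = 0.
  by rewrite mulmx_sum_row sum_ord2 !mxE.
rewrite -(mul0mx _ C) => /(row_free_inj Cf) /rowP v0.
by have := v0 0; have := v0 1; rewrite !mxE.
Qed.
End TwoByTwo.

(** * Covariant differentiation along a map *)

Section Connection.
Context {R : realType} {m n : nat}.
Local Notation e := (@delta_mx R 1 m 0).
Variables (O : set 'rV[R]_m) (om : 'I_m -> 'rV[R]_m -> 'M[R]_n).
Hypotheses (oO : open O) (omO : forall i, smooth_on O (om i)).

(** The covariant derivative in the [i]-th coordinate direction, for the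
    connection forms [om]; it acts on each row of [N]. *)
Definition covd p (i : 'I_m) (N : 'rV[R]_m -> 'M[R]_(p, n)) u : 'M[R]_(p, n) :=
  'D_(e i) N u + N u *m om i u.

Lemma near_covd p i (N N' : 'rV[R]_m -> 'M[R]_(p, n)) u :
  O u -> (forall y, O y -> N y = N' y) -> covd i N u = covd i N' u.
Proof.
move=> Ou NN'; have D : 'D_(e i) N u = 'D_(e i) N' u.
  by apply: near_eq_derive; apply: filterS (open_nbhs_nbhs (conj oO Ou)).
by rewrite /covd D (NN' u Ou).
Qed.

Lemma smooth_on_covd p i (N : 'rV[R]_m -> 'M[R]_(p, n)) :
  smooth_on O N -> smooth_on O (covd i N).
Proof.
move=> NO; apply: (smooth_on_add oO (smooth_on_partial i NO)).
exact: (smooth_on_mulmx oO NO (omO i)).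
Qed.

Lemma covd_add p i (N N' : 'rV[R]_m -> 'M[R]_(p, n)) u :
  differentiable N u -> differentiable N' u ->
  covd i (fun y => N y + N' y) u = covd i N u + covd i N' u.
Proof.
move=> dN dN'; rewrite /covd mulmxDl addrACA; congr (_ + _).
by apply: deriveD; exact: diff_derivable.
Qed.

Lemma covd_sum p i q (A : 'I_q -> 'rV[R]_m -> 'M[R]_(p, n)) u :
  (forall k, differentiable (A k) u) ->
  covd i (fun y => \sum_k A k y) u = \sum_k covd i (A k) u.
Proof.
move=> dA; rewrite /covd mulmx_suml big_split /=; congr (_ + _).
rewrite -fct_sumE; apply: derive_sum => k; exact: diff_derivable.
Qed.

Lemma covd_opp p i (N : 'rV[R]_m -> 'M[R]_(p, n)) u :
  differentiable N u -> covd i (fun y => - N y) u = - covd i N u.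
Proof.
move=> dN; rewrite /covd mulNmx opprD; congr (_ + _).
by apply: deriveN; exact: diff_derivable.
Qed.

Lemma covd_scale p i (f : 'rV[R]_m -> R) (N : 'rV[R]_m -> 'M[R]_(p, n)) u :
  differentiable f u -> differentiable N u ->
  covd i (fun y => f y *: N y) u = 'D_(e i) f u *: N u + f u *: covd i N u.
Proof.
move=> df dN; rewrite /covd (derive_scalemx _ df dN).
by rewrite -scalemxAl scalerDr addrA.
Qed.

Lemma covd_mulmx p q i (W : 'rV[R]_m -> 'M[R]_(p, q)) (A : 'rV[R]_m -> 'M[R]_(q, n)) u :
  differentiable W u -> differentiable A u ->
  covd i (fun y => W y *m A y) u = 'D_(e i) W u *m A u + W u *m covd i A u.
Proof.
move=> dW dA; rewrite /covd (derive_mulmx _ dW dA).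
by rewrite -mulmxA mulmxDr addrA.
Qed.

Lemma derive_commute p (N : 'rV[R]_m -> 'M[R]_(p, n)) i j u :
  smooth_on O N -> O u ->
  'D_(e i) ('D_(e j) N) u = 'D_(e j) ('D_(e i) N) u.
Proof.
move=> NO Ou; apply: derive_comm.
- by apply: filterS (open_nbhs_nbhs (conj oO Ou)) => y; exact: (NO [::]).
- exact: (NO [:: j]).
- exact: (NO [:: i]).
Qed.

(** The matrix on the right is the curvature of the connection [om]; the second
    derivatives of [N] cancel by [derive_commute]. *)
Lemma covd_commutator p (N : 'rV[R]_m -> 'M[R]_(p, n)) i j u :
  smooth_on O N -> O u ->
  covd i (covd j N) u - covd j (covd i N) u
  = N u *m ('D_(e i) (om j) u - 'D_(e j) (om i) u
            + om j u *m om i u - om i u *m om j u).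
Proof.
move=> NO Ou; have dN := smooth_on_differentiable NO Ou.
have E k l : covd k (covd l N) u =
    'D_(e k) ('D_(e l) N) u + 'D_(e k) N u *m om l u + 'D_(e l) N u *m om k u
    + N u *m ('D_(e k) (om l) u + om l u *m om k u).
  have dom := smooth_on_differentiable (omO l) Ou.
  rewrite {1}/covd /covd.
  have -> : 'D_(e k) (fun v => 'D_(e l) N v + N v *m om l v) u
      = 'D_(e k) ('D_(e l) N) u + 'D_(e k) (fun v => N v *m om l v) u.
    apply: deriveD; apply: diff_derivable; first exact: (NO [:: l]).
    exact: differentiable_mulmx.
  rewrite (derive_mulmx _ dN dom) mulmxDl mulmxDr -!addrA; congr (_ + (_ + _)).
  by rewrite addrCA -mulmxA.
have alg (a a' b c d d' : 'M[R]_(p, n)) :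
    a = a' -> (a + b + c + d) - (a' + c + b + d') = d - d'.
  by move=> <-; rewrite [a + c + b]addrAC opprD addrACA subrr add0r.
rewrite (E i j) (E j i).
apply: etrans (alg _ _ _ _ _ _ (derive_commute i j NO Ou)) _.
by rewrite -mulmxBr opprD addrACA addrA.
Qed.

End Connection.

(** * The Ricci equation of a conformally flat ambient metric *)

Section SurfaceGeometry.
Context {R : realType} {m n : nat}.
Local Notation e := (@delta_mx R 1 m 0).
Variables (O : set 'rV[R]_m) (phi : 'rV[R]_m -> 'rV[R]_n) (g : 'rV[R]_m -> 'M[R]_n).
Local Notation J u := ('J phi u).
Hypotheses (oO : open O) (phiO : smooth_on O phi) (gO : smooth_on O g).
Hypothesis gs : forall u, O u -> (g u)^T = g u.
Hypothesis gu : forall u, O u -> g u \in unitmx.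

(** The first fundamental form.  The ambient metric [g] is already restricted to
    the surface: it is a function of the parameter. *)
Definition gram u : 'M[R]_m := J u *m g u *m (J u)^T.
Hypothesis hu : forall u, O u -> gram u \in unitmx.

(** Right multiplication by [tan_coord u] gives the coordinates of the tangential
    part of a vector in the basis of the rows of ['J phi u]. *)
Definition tan_coord u : 'M[R]_(n, m) := g u *m (J u)^T *m invmx (gram u).
Definition nor_proj u : 'M[R]_n := 1%:M - tan_coord u *m J u.
Definition normal p u (a : 'M[R]_(p, n)) : Prop := a *m g u *m (J u)^T = 0.

Lemma normal_nor_proj p u (a : 'M[R]_(p, n)) : normal u a -> a *m nor_proj u = a.
Proof.
move=> na; rewrite /nor_proj mulmxBr mulmx1 /tan_coord !mulmxA na.
by rewrite !mul0mx subr0.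
Qed.

Lemma jacobian_tan_coord u : O u -> J u *m tan_coord u = 1%:M.
Proof. by move=> Ou; rewrite /tan_coord !mulmxA mulmxV // hu. Qed.

Lemma jacobian_nor_proj u : O u -> J u *m nor_proj u = 0.
Proof.
by move=> Ou; rewrite mulmxBr mulmx1 mulmxA jacobian_tan_coord // mul1mx subrr.
Qed.

Lemma nor_proj_normal p u (a : 'M[R]_(p, n)) : O u -> normal u (a *m nor_proj u).
Proof.
move=> Ou; rewrite /normal /nor_proj mulmxBr mulmx1 !mulmxBl /tan_coord.
rewrite !mulmxA -[X in _ - X]mulmxA -[X in _ - X]mulmxA.
by rewrite [J u *m _]mulmxA -[X in _ - X]mulmxA mulVmx ?hu // mulmx1 subrr.
Qed.

Lemma nor_proj_pair p u (a : 'M[R]_(p, n)) :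
  O u -> normal u a -> nor_proj u *m g u *m a^T = g u *m a^T.
Proof.
move=> Ou na; rewrite /nor_proj !mulmxBl mul1mx.
have -> : tan_coord u *m J u *m g u *m a^T = tan_coord u *m (a *m g u *m (J u)^T)^T.
  by rewrite !trmx_mul trmxK gs // !mulmxA.
by rewrite na trmx0 mulmx0 subr0.
Qed.

Lemma jacobian_pair p u (a : 'M[R]_(p, n)) :
  O u -> normal u a -> J u *m g u *m a^T = 0.
Proof.
move=> Ou na; have -> : J u *m g u *m a^T = (a *m g u *m (J u)^T)^T.
  by rewrite !trmx_mul trmxK gs // !mulmxA.
by rewrite na trmx0.
Qed.

Lemma smooth_on_J : smooth_on O (fun u => J u).
Proof. exact: smooth_on_jacobian. Qed.

Lemma smooth_on_gram : smooth_on O gram.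
Proof.
apply: (smooth_on_mulmx oO (smooth_on_mulmx oO smooth_on_J gO)).
exact: (smooth_on_trmx oO smooth_on_J).
Qed.

Lemma smooth_on_tan_coord : smooth_on O tan_coord.
Proof.
apply: (smooth_on_mulmx oO _ (smooth_on_invmx oO hu smooth_on_gram)).
exact: (smooth_on_mulmx oO gO (smooth_on_trmx oO smooth_on_J)).
Qed.

Lemma smooth_on_nor_proj : smooth_on O nor_proj.
Proof.
apply: (smooth_on_subr oO (@smooth_on_cst _ _ _ O 1%:M)).
exact: (smooth_on_mulmx oO smooth_on_tan_coord smooth_on_J).
Qed.

(** The connection forms of the Levi-Civita connection of the ambient metric,
    restricted to the surface. *)
Variable om : 'I_m -> 'rV[R]_m -> 'M[R]_n.
Hypothesis omO : forall i, smooth_on O (om i).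
Hypothesis om_metric : forall i u, O u ->
  'D_(e i) g u = om i u *m g u + g u *m (om i u)^T.
Hypothesis om_torsion_free : forall i j u, O u ->
  row j (covd om i (fun v => J v) u) = row i (covd om j (fun v => J v) u).

Definition normal_covd p i (N : 'rV[R]_m -> 'M[R]_(p, n)) u :=
  covd om i N u *m nor_proj u.

(** The second fundamental form [g(nabla_(e_i) e_k, a)] in the direction of the
    normal vector [a]. *)
Definition second_form u (a : 'rV[R]_n) : 'M[R]_m :=
  \matrix_(i, k) (covd om i (fun v => J v) u *m g u *m a^T) k 0.

Lemma second_form_sym u a : O u -> (second_form u a)^T = second_form u a.
Proof.
move=> Ou.
have E i k : second_form u a i k
    = (row k (covd om i (fun v => J v) u) *m (g u *m a^T)) 0 0.
  by rewrite -row_mul mxE [RHS]mxE mulmxA.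
by apply/matrixP => i k; rewrite mxE !E (om_torsion_free i k Ou).
Qed.

Lemma row_second_form u a i :
  row i (second_form u a) = (covd om i (fun v => J v) u *m g u *m a^T)^T.
Proof. by apply/rowP => k; rewrite !mxE. Qed.

(** The Weingarten equation, from the derivative of the relation
    [g(N, e_k) = 0]. *)
Lemma covd_normal N i u : smooth_on O N -> (forall v, O v -> normal v (N v)) -> O u ->
  covd om i N u *m g u *m (J u)^T = - row i (second_form u (N u)).
Proof.
move=> NO nN Ou.
have dN := smooth_on_differentiable NO Ou.
have dg := smooth_on_differentiable gO Ou.
have dJ := smooth_on_differentiable smooth_on_J Ou.
have dNg := differentiable_mulmx dN dg.
(* The relation to be differentiated: [N] stays normal near [u]. *)
have D0 : 'D_(e i) (fun v => N v *m g v *m (J v)^T) u = 0.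
  rewrite -[RHS](derive_cst 0 u (e i)); apply: near_eq_derive.
  by apply: filterS (open_nbhs_nbhs (conj oO Ou)) => v /nN.
rewrite (derive_mulmx _ dNg (differentiable_trmx dJ)) in D0.
rewrite (derive_mulmx _ dN dg) (derive_trmx _ dJ) (om_metric i Ou) in D0.
rewrite row_second_form /covd.
move: ('D_(e i) N u) ('D_(e i) (fun v => J v) u) D0 => DN DJ D0.
apply/eqP; rewrite -addr_eq0 -[X in _ == X]D0; apply/eqP.
rewrite !trmx_mul trmxK gs // linearD /= trmx_mul.
rewrite !(mulmxDl, mulmxDr) !mulmxA -!addrA; congr (_ + (_ + _)); exact: addrC.
Qed.

(** The connection forms [omt] of a flat metric [e^(2c) g], the differential [dc]
    of [c] on the ambient space, and its restriction [th] to the surface. *)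
Variables (omt : 'I_m -> 'rV[R]_m -> 'M[R]_n) (dc : 'rV[R]_m -> 'rV[R]_n)
  (th : 'I_m -> 'rV[R]_m -> R).
Hypothesis omtO : forall i, smooth_on O (omt i).
Hypothesis thO : forall i, @smooth_on R m R^o O (th i).
Hypothesis omt_conformal : forall i u, O u ->
  omt i u = om i u + (th i u)%:M + (dc u)^T *m row i (J u)
            - (row i (J u) *m g u)^T *m (dc u *m invmx (g u)).
Hypothesis th_closed : forall i j u, O u ->
  'D_(e i) (th j) u = 'D_(e j) (th i) u.
Hypothesis omt_flat : forall i j u, O u ->
  'D_(e i) (omt j) u - 'D_(e j) (omt i) u
  + omt j u *m omt i u - omt i u *m omt j u = 0.

Lemma covd_conformal p (A : 'rV[R]_m -> 'M[R]_(p, n)) i u : O u ->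
  covd omt i A u = covd om i A u + th i u *: A u
    + (A u *m (dc u)^T) *m row i (J u)
    - A u *m (row i (J u) *m g u)^T *m (dc u *m invmx (g u)).
Proof.
move=> Ou; rewrite /covd omt_conformal // mulmxBr !mulmxDr !addrA !mulmxA.
by rewrite -mul_mx_scalar.
Qed.

Lemma normal_row_jacobian p u (a : 'M[R]_(p, n)) i :
  O u -> normal u a -> a *m (row i (J u) *m g u)^T = 0.
Proof.
move=> Ou na; rewrite rowE -mulmxA trmx_mul trmx_mul gs // !mulmxA.
by rewrite [a *m _ *m _]na mul0mx.
Qed.

(** Conformally related metrics have the same normal spaces and the same normal
    projection, and on normal fields their normal connections differ by the
    one-form [th]: of the two other correction terms, one is tangent and the
    other has as factor the product of a normal and a tangent vector, which is
    zero. *)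
Lemma normal_covd_conformal p (N : 'rV[R]_m -> 'M[R]_(p, n)) i u :
  O u -> normal u (N u) ->
  normal_covd i N u = covd omt i N u *m nor_proj u - th i u *: N u.
Proof.
move=> Ou nN; rewrite covd_conformal // normal_row_jacobian // mul0mx subr0.
rewrite /normal_covd; move: (covd om i N u) => c.
rewrite !mulmxDl -[_ *m row i (J u) *m _]mulmxA rowE -[_ *m J u *m _]mulmxA.
rewrite jacobian_nor_proj // !mulmx0 addr0 -scalemxAl (normal_nor_proj nN).
by rewrite addrK.
Qed.

Lemma normal_normal_covd p (N : 'rV[R]_m -> 'M[R]_(p, n)) i u :
  O u -> normal u (normal_covd i N u).
Proof. by move=> Ou; exact: nor_proj_normal. Qed.

Lemma smooth_on_normal_covd p (N : 'rV[R]_m -> 'M[R]_(p, n)) i :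
  smooth_on O N -> smooth_on O (normal_covd i N).
Proof.
move=> NO; apply: (smooth_on_mulmx oO _ smooth_on_nor_proj).
exact: (smooth_on_covd oO omO i NO).
Qed.

(** The coordinates of the tangential part of the flat derivative of a normal
    field, that is, the Weingarten operator of the flat metric. *)
Definition flat_tan p i (N : 'rV[R]_m -> 'M[R]_(p, n)) u : 'M[R]_(p, m) :=
  covd omt i N u *m tan_coord u.

(** The normal projection of the flat derivative is the flat derivative minus
    [flat_tan i N u *m 'J phi u].  When this is differentiated again and
    projected, the derivative of [flat_tan] disappears, since it multiplies the
    tangent vectors ['J phi u]. *)
Lemma normal_covd_iter p (N : 'rV[R]_m -> 'M[R]_(p, n)) i j u :
  smooth_on O N -> (forall v, O v -> normal v (N v)) -> O u ->
  normal_covd i (normal_covd j N) u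
  = covd omt i (covd omt j N) u *m nor_proj u
    - flat_tan j N u *m covd omt i (fun v => J v) u *m nor_proj u
    - 'D_(e i) (th j) u *: N u
    - (th j u *: (covd omt i N u *m nor_proj u)
       + th i u *: (covd omt j N u *m nor_proj u))
    + (th i u * th j u) *: N u.
Proof.
move=> NO nN Ou.
rewrite (normal_covd_conformal i Ou (normal_normal_covd N j Ou)).
rewrite (normal_covd_conformal j Ou (nN u Ou)).
have cO := smooth_on_covd oO omtO j NO.
have WO : smooth_on O (flat_tan j N) := smooth_on_mulmx oO cO smooth_on_tan_coord.
have WJO := smooth_on_mulmx oO WO smooth_on_J.
have tNO := smooth_on_scale oO (thO j) NO.
have E v : O v -> normal_covd j N v =
    covd omt j N v + - (flat_tan j N v *m J v) + - (th j v *: N v).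
  move=> Ov; rewrite (normal_covd_conformal j Ov (nN v Ov)).
  by rewrite /nor_proj mulmxBr mulmx1 mulmxA.
rewrite (near_covd omt oO i Ou E).
have d1 := smooth_on_differentiable cO Ou.
have d2 := smooth_on_differentiable WJO Ou.
have d3 := smooth_on_differentiable tNO Ou.
have d2' := smooth_on_differentiable (smooth_on_opp oO WJO) Ou.
have d3' := smooth_on_differentiable (smooth_on_opp oO tNO) Ou.
rewrite (covd_add _ i (differentiableD d1 d2') d3') (covd_add _ i d1 d2').
rewrite (covd_opp _ i d2) (covd_opp _ i d3).
rewrite (covd_mulmx _ i (smooth_on_differentiable WO Ou) (smooth_on_differentiable smooth_on_J Ou)).
rewrite (covd_scale _ i (smooth_on_differentiable (thO j) Ou) (smooth_on_differentiable NO Ou)).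
move: ('D_(e i) (th j) u) ('D_(e i) (flat_tan j N) u) => Dth DW.
move: (covd omt i (covd omt j N) u) (covd omt i (fun v => J v) u) => c1 c2.
move: (covd omt i N u) (covd omt j N u) (flat_tan j N u) => c3 c4 w.
rewrite !(mulmxDl, mulNmx) -[DW *m _ *m _]mulmxA jacobian_nor_proj // mulmx0 add0r.
rewrite -!scalemxAl (normal_nor_proj (nN u Ou)).
by rewrite scalerBr scalerA !opprD !opprK !addrA.
Qed.

(** Antisymmetrization removes the second flat derivatives by [omt_flat], the
    derivatives of [th] by [th_closed], and all the terms symmetric in [i] and
    [j]; only the flat second fundamental form is left. *)
Lemma normal_covd_commutator p (N : 'rV[R]_m -> 'M[R]_(p, n)) i j u :
  smooth_on O N -> (forall v, O v -> normal v (N v)) -> O u ->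
  normal_covd i (normal_covd j N) u - normal_covd j (normal_covd i N) u
  = flat_tan i N u *m covd omt j (fun v => J v) u *m nor_proj u
    - flat_tan j N u *m covd omt i (fun v => J v) u *m nor_proj u.
Proof.
move=> NO nN Ou; rewrite (normal_covd_iter i j NO nN Ou) (normal_covd_iter j i NO nN Ou).
have C : covd omt i (covd omt j N) u = covd omt j (covd omt i N) u.
  by apply/eqP; rewrite -subr_eq0 (covd_commutator oO omtO) // omt_flat // mulmx0.
rewrite C (th_closed i j Ou) [th j u * th i u]mulrC.
rewrite [th j u *: (covd omt i N u *m _) + _]addrC.
have alg (a b b' c d f : 'M[R]_(p, n)) :
    (a - b - c - d + f) - (a - b' - c - d + f) = b' - b.
  have cancel (x y z : 'M[R]_(p, n)) : x + z - (y + z) = x - y.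
    by rewrite opprD addrACA subrr addr0.
  by rewrite !cancel opprB addrC addrA subrK.
exact: alg.
Qed.

(** The second fundamental form of the flat metric, without its conformal
    factor. *)
Definition conformal_form u (a : 'rV[R]_n) : 'M[R]_m :=
  second_form u a - (a *m (dc u)^T) 0 0 *: gram u.

Lemma gram_sym u : O u -> (gram u)^T = gram u.
Proof. by move=> Ou; rewrite /gram !trmx_mul trmxK gs // mulmxA. Qed.

Lemma flat_covd_jacobian_pair u (a : 'rV[R]_n) i : O u -> normal u a ->
  covd omt i (fun v => J v) u *m g u *m a^T = (row i (conformal_form u a))^T.
Proof.
move=> Ou na; rewrite linearB /= row_second_form linearB /= trmxK.
rewrite covd_conformal //; move: (covd om i _ u) => c.
have J0 := jacobian_pair Ou na.
have R0 : J u *m (dc u)^T *m row i (J u) *m g u *m a^T = 0.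
  by rewrite rowE -!mulmxA [J u *m (g u *m _)]mulmxA J0 !mulmx0.
rewrite !mulmxBl !mulmxDl -!scalemxAl J0 R0 scaler0 !addr0.
rewrite linearZ /= linearZ /=.
congr (_ - _); rewrite -!mulmxA mulKmx ?gu //.
have -> : dc u *m a^T = ((a *m (dc u)^T) 0 0)%:M.
  have <- : (a *m (dc u)^T)^T = dc u *m a^T by rewrite trmx_mul trmxK.
  by rewrite [LHS]mx11_scalar [in LHS]mxE.
rewrite mulmxA mul_mx_scalar !rowE; congr (_ *: _).
by rewrite [RHS]trmx_mul gram_sym // !trmx_mul gs // /gram !mulmxA.
Qed.

Lemma flat_tan_normal (N : 'rV[R]_m -> 'rV[R]_n) i u :
  smooth_on O N -> (forall v, O v -> normal v (N v)) -> O u ->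
  flat_tan i N u = - row i (conformal_form u (N u)) *m invmx (gram u).
Proof.
move=> NO nN Ou; rewrite /flat_tan /tan_coord !mulmxA; congr (_ *m _).
have C := covd_normal i NO nN Ou.
rewrite covd_conformal // (normal_row_jacobian i Ou (nN u Ou)) mul0mx subr0.
move: (covd om i N u) C => c C; rewrite !mulmxDl C -!scalemxAl [N u *m g u *m _]nN // scaler0 addr0.
rewrite linearB /= opprB addrC; congr (_ + _).
rewrite [in LHS](mx11_scalar (N u *m _)) -!mulmxA mul_scalar_mx linearZ /= !rowE.
by rewrite /gram !mulmxA.
Qed.

(** Multiples of [h] added to [B] and [B'] only change [B h^-1 B'] by symmetric
    matrices, which is why the conformal factor leaves no trace in the Ricci
    equation. *)
Lemma antisym_conformal (B B' h : 'M[R]_m) (s t : R) :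
  h \in unitmx -> h^T = h -> B^T = B -> B'^T = B' ->
  let K := (B - s *: h) *m invmx h *m (B' - t *: h) in
  K - K^T = B *m invmx h *m B' - (B *m invmx h *m B')^T.
Proof.
move=> hU hs Bs Bs' K.
have -> : K = B *m invmx h *m B' - (s *: B' + t *: B) + (s * t) *: h.
  rewrite /K mulmxBl !mulmxBr !mulmxBl -!scalemxAl -!scalemxAr mulmxV // mul1mx.
  rewrite -[B *m _ *m h]mulmxA mulVmx // mulmx1 mul1mx scalerA !opprD !opprK.
  by rewrite !addrA mulrC.
move: (B *m invmx h *m B') => X.
have Ys : (s *: B' + t *: B)^T = s *: B' + t *: B.
  by rewrite [LHS]raddfD /= [(s *: _)^T]linearZ [(t *: _)^T]linearZ /= Bs Bs'.
have Zs : ((s * t) *: h)^T = (s * t) *: h by rewrite [LHS]linearZ /= hs.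
move: (_ + _) (_ *: h) Ys Zs => Y Z Ys Zs.
rewrite [(_ + Z)^T]raddfD /= [(_ - Y)^T]raddfB /= Ys Zs.
by rewrite opprD addrACA subrr addr0 opprB addrA subrK.
Qed.

(** The Ricci equation without curvature term.  Its right-hand side is the
    antisymmetric part of a product of second fundamental forms, first obtained
    for the flat metric and then rewritten with [antisym_conformal]. *)
Lemma ricci (N : 'rV[R]_m -> 'rV[R]_n) (a : 'rV[R]_n) i j u :
  smooth_on O N -> (forall v, O v -> normal v (N v)) -> O u -> normal u a ->
  let K := second_form u (N u) *m invmx (gram u) *m second_form u a in
  ((normal_covd i (normal_covd j N) u - normal_covd j (normal_covd i N) u)
    *m g u *m a^T) 0 0 = K j i - K i j.
Proof.
move=> NO nN Ou na K; rewrite normal_covd_commutator //.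
have P (k l : 'I_m) : ((flat_tan k N u *m covd omt l (fun v => J v) u *m nor_proj u)
     *m g u *m a^T) 0 0
    = - (conformal_form u (N u) *m invmx (gram u) *m conformal_form u a) k l.
  have -> : flat_tan k N u *m covd omt l (fun v => J v) u *m nor_proj u *m g u *m a^T
      = flat_tan k N u *m (covd omt l (fun v => J v) u *m g u *m a^T).
    move: (flat_tan k N u) (covd omt l _ u) => F C.
    by rewrite -!mulmxA [nor_proj u *m _]mulmxA nor_proj_pair.
  rewrite flat_covd_jacobian_pair // flat_tan_normal // !mulNmx mxE; congr (- _).
  have Bs : (conformal_form u a)^T = conformal_form u a.
    by rewrite [LHS]raddfB /= second_form_sym // linearZ /= gram_sym.
  rewrite -row_mul tr_row Bs mxE [RHS]mxE; apply: eq_bigr => q _.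
  by rewrite [row _ _ _ _]mxE [col _ _ _ _]mxE.
have sub00 (X Y : 'M[R]_1) : (X - Y) 0 0 = X 0 0 - Y 0 0 by rewrite !mxE.
rewrite 2!mulmxBl sub00 !P opprK addrC.
have := antisym_conformal ((N u *m (dc u)^T) 0 0) ((a *m (dc u)^T) 0 0) (hu Ou)
  (gram_sym Ou) (second_form_sym (N u) Ou) (second_form_sym a Ou).
have subE (X : 'M[R]_m) : (X - X^T) j i = X j i - X i j by rewrite !mxE.
by move=> /= /(congr1 (fun X : 'M[R]_m => X j i)); rewrite !subE.
Qed.

End SurfaceGeometry.

(** * Extrinsic geometry of a parametrized surface *)

Section Bridge.
Context {R : realType}.
Local Notation e := (@delta_mx R 1 2 0).
Variables (G : 'rV[R]_4 -> 'M[R]_4) (phi : 'rV[R]_2 -> 'rV[R]_4).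
Variables (O : set 'rV[R]_2) (U : set 'rV[R]_4).
Hypotheses (oO : open O) (oU : open U).
Hypotheses (phiO : smooth_on O phi) (phiU : forall u, O u -> U (phi u)).
Hypothesis GU : smooth_on U G.
Hypothesis Gs : forall x, U x -> (G x)^T = G x.
Hypothesis Gu : forall x, U x -> G x \in unitmx.
Local Notation g := (fun u => G (phi u)).
Local Notation J u := ('J phi u).
Hypothesis hu : forall u, O u -> gram phi g u \in unitmx.

(** Connection forms along [phi] of the ambient connection of matrices [C]. *)
Definition pullback (C : 'I_4 -> 'rV[R]_4 -> 'M[R]_4) (i : 'I_2) u : 'M[R]_4 :=
  \sum_k J u i k *: C k (phi u).

Local Notation om := (pullback (christoffel_mx G)).

Lemma smooth_on_metric : smooth_on O g.
Proof. exact: (smooth_on_comp oO oU phiO phiU GU). Qed.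

Lemma smooth_on_pullback C i :
  (forall k, smooth_on U (C k)) -> smooth_on O (pullback C i).
Proof.
move=> CU; apply: (smooth_on_sum oO) => k.
apply: (smooth_on_scale oO).
  exact: (smooth_on_entry oO i k (smooth_on_jacobian oO phiO)).
exact: (smooth_on_comp oO oU phiO phiU (CU k)).
Qed.

Lemma smooth_on_om i : smooth_on O (om i).
Proof.
by apply: smooth_on_pullback => k; exact: smooth_on_christoffel_mx.
Qed.

Lemma covE X N u : differentiable N u ->
  cov G phi X N u = \sum_i X u 0 i *: covd om i N u.
Proof.
move=> dN; rewrite /cov (derive_lincomb _ dN) christoffelE.
have -> : \sum_i X u 0 i *: covd om i N u
    = \sum_i X u 0 i *: 'D_(e i) N u + \sum_i X u 0 i *: (N u *m om i u).
  by rewrite -big_split /=; apply: eq_bigr => i _; rewrite -scalerDr.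
congr (_ + _).
have -> : \sum_i X u 0 i *: (N u *m om i u)
    = \sum_i \sum_k X u 0 i *: (J u i k *: (N u *m christoffel_mx G k (phi u))).
  apply: eq_bigr => i _; rewrite -scaler_sumr; congr (_ *: _).
  by rewrite mulmx_sumr; apply: eq_bigr => k _; rewrite scalemxAr.
rewrite exchange_big /=; apply: eq_bigr => k _.
by rewrite mxE scaler_suml; apply: eq_bigr => i _; rewrite scalerA.
Qed.

Lemma tan_partE u a : tan_part G phi u a = a *m tan_coord phi g u *m J u.
Proof. by rewrite /tan_part /tan_coord !mulmxA. Qed.

Lemma nor_partE u a : nor_part G phi u a = a *m nor_proj phi g u.
Proof. by rewrite /nor_part tan_partE -[in LHS]mulmxA /nor_proj mulmxBr mulmx1. Qed.

Lemma normal_connE X N u : differentiable N u ->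
  normal_conn G phi X N u = \sum_i X u 0 i *: normal_covd phi g om i N u.
Proof.
move=> dN; rewrite /normal_conn nor_partE covE // mulmx_suml.
by apply: eq_bigr => i _; rewrite -scalemxAl.
Qed.

Lemma near_normal_conn X N N' u : O u -> (forall v, O v -> N v = N' v) ->
  normal_conn G phi X N u = normal_conn G phi X N' u.
Proof.
move=> Ou NN'; have D : 'D_(X u) N u = 'D_(X u) N' u.
  by apply: near_eq_derive; apply: filterS (open_nbhs_nbhs (conj oO Ou)).
by rewrite /normal_conn /cov D (NN' u Ou).
Qed.

(** The first sum only depends on the derivative of [Y] along [X]; in the
    curvature it cancels against the bracket. *)
Lemma normal_conn_iter X Y N u : smooth_on O Y -> smooth_on O N -> O u ->
  normal_conn G phi X (normal_conn G phi Y N) u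
  = \sum_j ('D_(X u) Y u) 0 j *: normal_covd phi g om j N u
    + \sum_i \sum_j (X u 0 i * Y u 0 j)
        *: normal_covd phi g om i (normal_covd phi g om j N) u.
Proof.
move=> YO NO Ou.
have ncO j := smooth_on_normal_covd oO phiO smooth_on_metric hu smooth_on_om j NO.
have Yj j := smooth_on_entry oO 0 j YO.
pose M := fun v => \sum_j Y v 0 j *: normal_covd phi g om j N v.
have MO : smooth_on O M.
  by apply: (smooth_on_sum oO) => j; exact: (smooth_on_scale oO).
have E v : O v -> normal_conn G phi Y N v = M v.
  by move=> Ov; rewrite normal_connE //; exact: (smooth_on_differentiable NO Ov).
have -> : normal_conn G phi X (normal_conn G phi Y N) u = normal_conn G phi X M u.
  exact: near_normal_conn.
rewrite normal_connE; last exact: (smooth_on_differentiable MO Ou).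
have ncM i : normal_covd phi g om i M u
    = \sum_j ('D_(e i) Y u 0 j *: normal_covd phi g om j N u
       + Y u 0 j *: normal_covd phi g om i (normal_covd phi g om j N) u).
  rewrite {1}/normal_covd /M.
  have -> : covd om i (fun v => \sum_j Y v 0 j *: normal_covd phi g om j N v) u
     = \sum_j covd om i (fun v => Y v 0 j *: normal_covd phi g om j N v) u.
    apply: covd_sum => j.
    exact: (smooth_on_differentiable (smooth_on_scale oO (Yj j) (ncO j)) Ou).
  rewrite mulmx_suml; apply: eq_bigr => j _.
  rewrite (covd_scale _ i (smooth_on_differentiable (Yj j) Ou)
    (smooth_on_differentiable (ncO j) Ou)).
  rewrite mulmxDl -!scalemxAl (derive_entry _ 0 j (smooth_on_differentiable YO Ou)).
  by rewrite (normal_nor_proj (normal_normal_covd hu om N j Ou)).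
rewrite (eq_bigr _ (fun i _ => congr1 (fun Z => X u 0 i *: Z) (ncM i))).
rewrite (derive_lincomb (X u) (smooth_on_differentiable YO Ou)).
under eq_bigr => i _ do rewrite scaler_sumr.
under [X in _ = X + _]eq_bigr => j _ do rewrite summxE scaler_suml.
rewrite [X in _ = X + _]exchange_big -big_split /=; apply: eq_bigr => i _.
rewrite -big_split /=; apply: eq_bigr => j _.
by rewrite scalerDr !scalerA mxE.
Qed.

Lemma curvature_normal_conn X Y N u :
  smooth_on O X -> smooth_on O Y -> smooth_on O N -> O u ->
  curvature (normal_conn G phi) X Y N u
  = \sum_i \sum_j (X u 0 i * Y u 0 j)
      *: (normal_covd phi g om i (normal_covd phi g om j N) u
          - normal_covd phi g om j (normal_covd phi g om i N) u).
Proof.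
move=> XO YO NO Ou; rewrite /curvature (normal_conn_iter X YO NO Ou) (normal_conn_iter Y XO NO Ou).
rewrite (normal_connE _ (smooth_on_differentiable NO Ou)) /bracket.
have subE (a b : 'rV[R]_2) i : (a - b) 0 i = a 0 i - b 0 i by rewrite !mxE.
under [X in _ - _ - X]eq_bigr => i _ do rewrite subE scalerBl.
rewrite [X in _ - _ - X]big_split /= sumrN.
under [RHS]eq_bigr => i _ do under eq_bigr => j _ do rewrite scalerBr.
under [RHS]eq_bigr => i _ do rewrite big_split /= sumrN.
rewrite [RHS]big_split /= sumrN.
have alg (a b c d d' : 'rV[R]_4) : d = d' -> a + c - (b + d) - (a - b) = c - d'.
  by move=> <-; rewrite opprD addrACA [LHS]addrC addKr.
apply: alg; rewrite exchange_big /=; apply: eq_bigr => i _; apply: eq_bigr => j _.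
by rewrite mulrC.
Qed.

Lemma phi_differentiable u : O u -> differentiable phi u.
Proof. exact: smooth_on_differentiable. Qed.

Lemma derive_comp_phi p q (A : 'rV[R]_4 -> 'M[R]_(p, q)) i u :
  smooth_on U A -> O u ->
  'D_(e i) (fun v => A (phi v)) u = \sum_k J u i k *: 'D_(delta_mx 0 k) A (phi u).
Proof.
move=> AU Ou; have dphi := phi_differentiable Ou.
rewrite (derive_comp_lincomb _ dphi (smooth_on_differentiable AU (phiU Ou))).
by apply: eq_bigr => k _; rewrite (jacobianE _ _ dphi).
Qed.

Lemma om_metric i u : O u -> 'D_(e i) g u = om i u *m g u + g u *m (om i u)^T.
Proof.
move=> Ou; rewrite (derive_comp_phi _ GU Ou) /pullback raddf_sum /=.
rewrite mulmx_suml mulmx_sumr -big_split /=; apply: eq_bigr => k _.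
rewrite [(_ *: christoffel_mx G k _)^T]linearZ /= -scalemxAl -scalemxAr -scalerDr.
rewrite christoffel_mx_compat ?Gu //; try exact: phiU.
  by apply: filterS (open_nbhs_nbhs (conj oU (phiU Ou))).
exact: (smooth_on_differentiable GU (phiU Ou)).
Qed.

Lemma derive_jacobian_sym i j k u : O u ->
  'D_(e i) (fun v => J v) u j k = 'D_(e j) (fun v => J v) u i k.
Proof.
move=> Ou.
have E i' j' : 'D_(e i') (fun v => J v) u j' k = ('D_(e i') ('D_(e j') phi) u) 0 k.
  rewrite (derive_entry _ j' k (smooth_on_differentiable (smooth_on_jacobian oO phiO) Ou)).
  rewrite (derive_entry _ 0 k (smooth_on_differentiable (smooth_on_partial j' phiO) Ou)).
  apply: near_eq_derive; apply: filterS (open_nbhs_nbhs (conj oO Ou)) => v Ov.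
  exact: jacobianE (phi_differentiable Ov).
apply: etrans (E i j) _; apply: etrans (esym (E j i)).
exact: (congr1 (fun r : 'rV[R]_4 => r 0 k) (derive_commute oO i j phiO Ou)).
Qed.

Lemma om_torsion_free i j u : O u ->
  row j (covd om i (fun v => J v) u) = row i (covd om j (fun v => J v) u).
Proof.
move=> Ou; apply/rowP => k.
have addE (A B : 'M[R]_(2, 4)) i' : row i' (A + B) 0 k = A i' k + B i' k by rewrite !mxE.
rewrite /covd !addE; congr (_ + _); first exact: derive_jacobian_sym.
have E i' j' : (J u *m om i' u) j' k
    = \sum_l \sum_q J u j' l * (J u i' q * christoffel_mx G q (phi u) l k).
  rewrite mxE; apply: eq_bigr => l _; rewrite /pullback summxE mulr_sumr.
  by apply: eq_bigr => q _; congr (_ * _); rewrite [LHS]mxE.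
rewrite !E exchange_big /=; apply: eq_bigr => q _; apply: eq_bigr => l _.
rewrite mulrCA; congr (_ * (_ * _)); apply: christoffel_mx_sym.
  by apply: filterS (open_nbhs_nbhs (conj oU (phiU Ou))).
exact: (smooth_on_differentiable GU (phiU Ou)).
Qed.

(** The curvature form of a pulled-back connection is the pull-back of its
    curvature form: the second derivatives of [phi] are symmetric and cancel. *)
Lemma pullback_flat (C : 'I_4 -> 'rV[R]_4 -> 'M[R]_4) i j u :
  (forall k, smooth_on U (C k)) ->
  (forall x, U x -> forall k l,
     'D_(delta_mx 0 k) (C l) x - 'D_(delta_mx 0 l) (C k) x
     + C l x *m C k x - C k x *m C l x = 0) -> O u ->
  'D_(e i) (pullback C j) u - 'D_(e j) (pullback C i) u
  + pullback C j u *m pullback C i u - pullback C i u *m pullback C j u = 0.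
Proof.
move=> CU flatC Ou.
have JO := smooth_on_jacobian oO phiO.
have D i' j' : 'D_(e i') (pullback C j') u
    = \sum_k ('D_(e i') (fun v => J v) u) j' k *: C k (phi u)
      + \sum_k \sum_l (J u j' k * J u i' l) *: 'D_(delta_mx 0 l) (C k) (phi u).
  have CO k := smooth_on_comp oO oU phiO phiU (CU k).
  have Jjk k := smooth_on_entry oO j' k JO.
  rewrite /pullback -fct_sumE derive_sum; last first.
    move=> k; apply: diff_derivable.
    exact: (smooth_on_differentiable (smooth_on_scale oO (Jjk k) (CO k)) Ou).
  rewrite -big_split /=; apply: eq_bigr => k _.
  rewrite (derive_scalemx _ (smooth_on_differentiable (Jjk k) Ou)
    (smooth_on_differentiable (CO k) Ou)) (derive_comp_phi _ (CU k) Ou).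
  rewrite -(derive_entry _ j' k (smooth_on_differentiable JO Ou)) scaler_sumr.
  by congr (_ + _); apply: eq_bigr => l _; rewrite scalerA.
have M i' j' : pullback C j' u *m pullback C i' u
    = \sum_k \sum_l (J u j' k * J u i' l) *: (C k (phi u) *m C l (phi u)).
  rewrite /pullback mulmx_suml; apply: eq_bigr => k _.
  rewrite mulmx_sumr; apply: eq_bigr => l _.
  by rewrite -scalemxAl -scalemxAr scalerA.
have S1 : \sum_k ('D_(e i) (fun v => J v) u) j k *: C k (phi u)
    = \sum_k ('D_(e j) (fun v => J v) u) i k *: C k (phi u).
  by apply: eq_bigr => k _; congr (_ *: _); exact: derive_jacobian_sym.
have swap (F : 'I_4 -> 'I_4 -> 'M[R]_4) :
    \sum_k \sum_l (J u i k * J u j l) *: F k l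
    = \sum_k \sum_l (J u j k * J u i l) *: F l k.
  rewrite exchange_big /=; apply: eq_bigr => k _; apply: eq_bigr => l _.
  by rewrite mulrC.
rewrite (D i j) (D j i) S1 !M !swap.
move: (\sum_k 'D_(e j) (fun v => J v) u i k *: C k (phi u)) => A.
have alg (B B' X X' : 'M[R]_4) : A + B - (A + B') + X - X' = B - B' + X - X'.
  by rewrite opprD addrACA subrr add0r.
rewrite alg -!sumrB -big_split -sumrB /= big1 // => k _.
rewrite -!sumrB -big_split -sumrB /= big1 // => l _.
by rewrite -scalerBr -scalerDr -scalerBr flatC ?scaler0 //; exact: phiU.
Qed.

Lemma normal_atP u a : normal_at G phi u a <-> normal phi g u a.
Proof.
rewrite /normal_at /normal /ip; split=> [H|H v]; last first.
  by rewrite trmx_mul mulmxA H mul0mx mxE.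
apply/rowP => i; rewrite [RHS]mxE -(H (e i)) trmx_mul mulmxA trmx_delta -colE.
by rewrite [RHS]mxE.
Qed.

Lemma weingartenE N u v :
  smooth_on O N -> (forall w, O w -> normal phi g w (N w)) -> O u ->
  weingarten G phi N u v
  = - (v *m second_form phi g om u (N u) *m invmx (gram phi g u) *m J u).
Proof.
move=> NO nN Ou; rewrite /weingarten tan_partE covE; last exact: (smooth_on_differentiable NO Ou).
rewrite -!mulNmx; congr (_ *m _).
rewrite /tan_coord !mulmxA; congr (_ *m _).
rewrite !mulmx_suml mulNmx [v *m _]mulmx_sum_row -sumrN; apply: eq_bigr => i _.
rewrite -!scalemxAl (covd_normal oO phiO smooth_on_metric _ om_metric i NO nN Ou) ?scalerN //.
by move=> w Ow; apply: Gs; exact: phiU.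
Qed.

Lemma mean_curvature_pair u a : O u -> normal phi g u a ->
  ip (g u) (mean_curvature G phi u) a
  = - \sum_i \sum_j invmx (gram phi g u) i j * second_form phi g om u a i j.
Proof.
move=> Ou na; rewrite /ip /mean_curvature !mulmx_suml summxE -sumrN.
apply: eq_bigr => i _; rewrite !mulmx_suml summxE -sumrN; apply: eq_bigr => j _.
rewrite -!scalemxAl mxE -mulrN; congr (_ * _).
have dJ := smooth_on_differentiable (smooth_on_jacobian oO phiO) Ou.
have dw : differentiable (cst (e j) : 'rV[R]_2 -> 'rV[R]_2) u by exact: differentiable_cst.
have covJ : cov G phi (cst (e i)) (fun v => e j *m J v) u
    = e j *m covd om i (fun v => J v) u.
  rewrite covE; last exact: (differentiable_mulmx dw dJ).
  have /= covdJ k := covd_mulmx om k dw dJ.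
  rewrite (bigD1 i) //= big1 => [|k ki]; last by rewrite [e i 0 k]mxE (negbTE ki) andbF scale0r.
  by rewrite [e i 0 i]mxE !eqxx scale1r addr0 covdJ derive_cst mul0mx add0r.
rewrite /Defs.shape covJ nor_partE !mulNmx mxE; congr (- _).
rewrite -!mulmxA [nor_proj _ _ _ *m _]mulmxA (nor_proj_pair (fun w Ow => Gs (phiU Ow)) Ou na).
by rewrite mulmxA -rowE -row_mul mxE [RHS]mxE mulmxA.
Qed.

(** The Weingarten operator is [- second_form *m invmx gram], and the factor of
    proportionality need not be prescribed: when [second_form] is [l *: gram],
    taking the trace shows that [- l] is half the product of the mean curvature
    vector and [N u]. *)
Lemma umbilicP N u :
  smooth_on O N -> (forall w, O w -> normal phi g w (N w)) -> O u ->
  (forall v, weingarten G phi N u v =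
     (2^-1 * ip (g u) (mean_curvature G phi u) (N u)) *: (v *m J u))
  <-> exists l, second_form phi g om u (N u) = l *: gram phi g u.
Proof.
move=> NO nN Ou.
have hU := hu Ou.
split=> [H|[l Bl] v].
  set s := 2^-1 * _ in H; exists (- s); apply/row_matrixP => i.
  have := H (e i); rewrite weingartenE //.
  move=> /(congr1 (fun X => X *m tan_coord phi g u *m gram phi g u)).
  rewrite mulNmx -[_ *m J u *m _]mulmxA (jacobian_tan_coord hu Ou) mulmx1.
  rewrite -scalemxAl -[_ *m J u *m _]mulmxA (jacobian_tan_coord hu Ou) mulmx1.
  rewrite mulNmx -[_ *m invmx _ *m _]mulmxA mulVmx // mulmx1 -scalemxAl -!rowE => E.
  by rewrite [row i (_ *: _)]linearZ /= scaleNr -E opprK.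
rewrite weingartenE // Bl -scalemxAr -mulmxA -!scalemxAl mulmxA -[v *m _ *m _]mulmxA.
rewrite mulmxV // mulmx1 (mean_curvature_pair Ou (nN u Ou)) -scaleNr; congr (_ *: _).
rewrite Bl.
have -> : \sum_i \sum_j invmx (gram phi g u) i j * (l *: gram phi g u) i j = l * 2.
  have gs : (gram phi g u)^T = gram phi g u.
    exact: (@gram_sym _ _ _ O phi g (fun w Ow => Gs (phiU Ow)) u Ou).
  have tr1 i : \sum_j invmx (gram phi g u) i j * (l *: gram phi g u) i j = l.
    rewrite (eq_bigr (fun j => l * (invmx (gram phi g u) i j * gram phi g u j i))).
      rewrite -mulr_sumr; have := mulVmx hU => /matrixP /(_ i i).
      by rewrite mxE [RHS]mxE eqxx mulr1n => ->; rewrite mulr1.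
    move=> j _; have gji : gram phi g u j i = gram phi g u i j by rewrite -{1}gs mxE.
    have -> : (l *: gram phi g u) i j = l * gram phi g u i j by rewrite mxE.
    by rewrite gji mulrCA.
  by rewrite (eq_bigr _ (fun i _ => tr1 i)) sumr_const card_ord mulr_natr.
by field.
Qed.

(** Projecting a constant vector extends any normal vector to a smooth normal
    field. *)
Definition normal_extension (a : 'rV[R]_4) : 'rV[R]_2 -> 'rV[R]_4 :=
  fun u => a *m nor_proj phi g u.

Lemma smooth_on_normal_extension a : smooth_on O (normal_extension a).
Proof.
apply: (smooth_on_mulmx oO (@smooth_on_cst _ _ _ O a)).
exact: (smooth_on_nor_proj oO phiO smooth_on_metric hu).
Qed.

Lemma normal_normal_extension a u : O u -> normal phi g u (normal_extension a u).
Proof. by move=> Ou; exact: (nor_proj_normal hu a Ou). Qed.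

Lemma normal_extensionE a u : normal phi g u a -> normal_extension a u = a.
Proof. exact: normal_nor_proj. Qed.

(** Tangent vectors are orthogonal to [F] as well, so that [F] is orthogonal to
    everything, and the metric is nondegenerate. *)
Lemma normal_eq0 u (F : 'rV[R]_4) : O u -> normal phi g u F ->
  (forall a : 'rV[R]_4, normal phi g u a -> (F *m g u *m a^T) 0 0 = 0) -> F = 0.
Proof.
move=> Ou nF H.
have F0 : F *m g u = 0.
  apply/rowP => i; rewrite [RHS]mxE; pose b : 'rV[R]_4 := delta_mx 0 i.
  have := H _ (nor_proj_normal hu b Ou).
  have -> : F *m g u *m (b *m nor_proj phi g u)^T = F *m g u *m b^T.
    rewrite /nor_proj mulmxBr mulmx1 linearB /= mulmxBr mulmxA [(_ *m J u)^T]trmx_mul.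
    by rewrite [X in _ - X]mulmxA [X in _ - X *m _]nF mul0mx subr0.
  by rewrite trmx_delta -colE mxE.
by rewrite -[F](mulmxK (Gu (phiU Ou))) F0 mul0mx.
Qed.

Section ConformallyFlat.
Variable c : 'rV[R]_4 -> R.
Hypothesis cU : @smooth_on R 4 R^o U c.
Local Notation Gt := (fun x => expR (2 * c x) *: G x).
Hypothesis Gt_flat : flat_on U Gt.

Definition conf_grad u : 'rV[R]_4 := grad c (phi u).
(** The one-form [d(c o phi)] in coordinates. *)
Definition conf_diff (i : 'I_2) u : R := \sum_k J u i k * grad c (phi u) 0 k.
Local Notation omt := (pullback (christoffel_mx Gt)).

Lemma smooth_on_grad : smooth_on U (grad c).
Proof.
apply: (smooth_on_matrix oU) => i j.
exact: (smooth_on_partial j cU).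
Qed.

Lemma christoffel_conformal k x : U x -> christoffel_mx Gt k x
  = christoffel_mx G k x + (grad c x 0 k)%:M + (grad c x)^T *m delta_mx 0 k
    - (row k (G x))^T *m (grad c x *m invmx (G x)).
Proof.
move=> Ux; rewrite christoffel_mx_conformal ?Gs ?Gu //; first last.
- exact: (smooth_on_differentiable cU Ux).
- exact: (smooth_on_differentiable GU Ux).
by rewrite [grad c x 0 k]mxE.
Qed.

Lemma smooth_on_christoffel_conformal k : smooth_on U (christoffel_mx Gt k).
Proof.
apply: smooth_on_ext oU (fun x Ux => esym (christoffel_conformal k Ux)) _.
have gU := smooth_on_grad.
apply: (smooth_on_subr oU).
  apply: (smooth_on_add oU).
    apply: (smooth_on_add oU); first exact: smooth_on_christoffel_mx.
    under eq_fun do rewrite -[_%:M]scalemx1.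
    exact: (smooth_on_scale oU (smooth_on_entry oU 0 k gU) (@smooth_on_cst _ _ _ U 1%:M)).
  apply: (smooth_on_mulmx oU (smooth_on_trmx oU gU)).
  exact: (@smooth_on_cst _ _ _ U (delta_mx 0 k)).
apply: (smooth_on_mulmx oU (smooth_on_trmx oU (smooth_on_row oU k GU))).
exact: (smooth_on_mulmx oU gU (smooth_on_invmx oU Gu GU)).
Qed.

Lemma smooth_on_conf_diff i : @smooth_on R 2 R^o O (conf_diff i).
Proof.
have -> : conf_diff i = (fun u => (J u *m (conf_grad u)^T) i 0).
  by apply/funext => u; rewrite [RHS]mxE; apply: eq_bigr => k _; congr (_ * _); rewrite [RHS]mxE.
apply: (smooth_on_entry oO); apply: (smooth_on_mulmx oO (smooth_on_jacobian oO phiO)).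
apply: (smooth_on_trmx oO); exact: (smooth_on_comp oO oU phiO phiU smooth_on_grad).
Qed.

Lemma conf_diffE i u : O u -> conf_diff i u = 'D_(e i) (fun v => c (phi v)) u.
Proof.
move=> Ou; have dphi := phi_differentiable Ou.
have dc := smooth_on_differentiable cU (phiU Ou).
apply: esym; apply: etrans (derive_comp_lincomb (e i) dphi dc) _.
apply: eq_bigr => k _; rewrite -(jacobianE _ _ dphi); congr (_ * _).
by rewrite [RHS]mxE.
Qed.

Lemma conf_diff_closed i j u : O u ->
  'D_(e i) (conf_diff j) u = 'D_(e j) (conf_diff i) u.
Proof.
move=> Ou; have cO := smooth_on_comp_real oO phiO phiU cU.
have near k : \near u, conf_diff k u = 'D_(e k) (fun v => c (phi v)) u.
  by apply: filterS (open_nbhs_nbhs (conj oO Ou)) => v; exact: conf_diffE.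
apply: etrans (near_eq_derive (e i) (near j)) _.
apply: etrans (esym (near_eq_derive (e j) (near i))).
apply: derive_comm_real.
- by apply: filterS (open_nbhs_nbhs (conj oO Ou)) => v; exact: smooth_on_differentiable.
- exact: (smooth_on_differentiable (smooth_on_partial j cO) Ou).
- exact: (smooth_on_differentiable (smooth_on_partial i cO) Ou).
Qed.

Lemma pullback_conformal i u : O u ->
  omt i u = om i u + (conf_diff i u)%:M + (conf_grad u)^T *m row i (J u)
            - (row i (J u) *m g u)^T *m (conf_grad u *m invmx (g u)).
Proof.
move=> Ou.
have T2 : (conf_diff i u)%:M = \sum_k J u i k *: ((grad c (phi u) 0 k)%:M : 'M[R]_4).
  by rewrite raddf_sum; apply: eq_bigr => k _; rewrite scale_scalar_mx.
have T3 : (conf_grad u)^T *m row i (J u) = \sum_k J u i k *: ((conf_grad u)^T *m delta_mx 0 k).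
  rewrite [row i _]row_sum_delta mulmx_sumr; apply: eq_bigr => k _.
  by rewrite scalemxAr; congr (_ *m (_ *: _)); rewrite [LHS]mxE.
have T4 (X : 'rV[R]_4) : (row i (J u) *m g u)^T *m X
    = \sum_k J u i k *: ((row k (g u))^T *m X).
  rewrite mulmx_sum_row linear_sum mulmx_suml; apply: eq_bigr => k _.
  by rewrite linearZ /= -scalemxAl; congr (_ *: _); rewrite [LHS]mxE.
rewrite T2 T3 T4 /pullback -!big_split -sumrB /=.
apply: eq_bigr => k _; rewrite christoffel_conformal; last exact: phiU.
by rewrite -!scalerDr -scalerBr.
Qed.

Lemma ricci_conformally_flat N a i j u :
  smooth_on O N -> (forall v, O v -> normal phi g v (N v)) -> O u -> normal phi g u a ->
  let B := second_form phi g om u in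
  let K := B (N u) *m invmx (gram phi g u) *m B a in
  ((normal_covd phi g om i (normal_covd phi g om j N) u
    - normal_covd phi g om j (normal_covd phi g om i N) u)
    *m g u *m a^T) 0 0 = K j i - K i j.
Proof.
move=> NO nN Ou na.
apply: (ricci oO phiO smooth_on_metric (fun v Ov => Gs (phiU Ov))
  (fun v Ov => Gu (phiU Ov)) hu om_metric om_torsion_free
  (fun k => smooth_on_pullback k smooth_on_christoffel_conformal)
  smooth_on_conf_diff pullback_conformal conf_diff_closed) => //.
move=> k l v Ov; apply: pullback_flat => //; first exact: smooth_on_christoffel_conformal.
move=> x Ux k' l'; apply: flat_christoffel_mx Gt_flat _ Ux _ _ => q y Uy.
exact: (smooth_on_differentiable (smooth_on_christoffel_conformal q) Uy).
Qed.

Lemma rank_conormal u : O u -> \rank (g u *m (J u)^T) = 2%N.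
Proof.
move=> Ou; apply/eqP; rewrite eqn_leq rank_leq_col /=.
have r2 : \rank (gram phi g u) = 2%N by rewrite mxrank_unit // hu.
apply: leq_trans (mxrankM_maxr (J u) (g u *m (J u)^T)).
by rewrite mulmxA [X in (_ <= X)%N]r2.
Qed.

Lemma second_form_lincomb u a b (x y : R) :
  second_form phi g om u (x *: a + y *: b)
  = x *: second_form phi g om u a + y *: second_form phi g om u b.
Proof.
apply/matrixP => i k; rewrite [LHS]mxE [(_ + _)^T]raddfD /= mulmxDr.
rewrite [(x *: a)^T]linearZ [(y *: b)^T]linearZ /= -!scalemxAr.
have E (C D : 'M[R]_2) : (x *: C + y *: D) i k = x * C i k + y * D i k by rewrite !mxE.
have E' (C D : 'cV[R]_2) : (x *: C + y *: D) k 0 = x * C k 0 + y * D k 0 by rewrite !mxE.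
by rewrite E E' [in RHS]mxE [second_form phi g om u b i k]mxE.
Qed.

Lemma normal_lincomb u (a b : 'rV[R]_4) (x y : R) :
  normal phi g u a -> normal phi g u b -> normal phi g u (x *: a + y *: b).
Proof. by rewrite /normal => na nb; rewrite !mulmxDl -!scalemxAl na nb !scaler0 addr0. Qed.

Section AtPoint.
Variable u : 'rV[R]_2.
Hypotheses (Ou : O u) (hpos : positive_definite (gram phi g u)).
Local Notation h := (gram phi g u).
Local Notation B := (second_form phi g om u).

Let hs : h^T = h.
Proof. exact: (@gram_sym _ _ _ O phi g (fun w Ow => Gs (phiU Ow)) u Ou). Qed.

Let Bs a : (B a)^T = B a.
Proof. exact: (@second_form_sym _ _ _ O phi g om om_torsion_free u a Ou). Qed.

Let d0 : symdet h != 0.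
Proof. by rewrite gt_eqF //; have [] := positive_definite_symdet hs hpos. Qed.

(** Each entry of the antisymmetric part is zero or plus or minus the triple
    product. *)
Lemma ricci_coplanar N b i j :
  smooth_on O N -> (forall v, O v -> normal phi g v (N v)) -> normal phi g u b ->
  triple (B (N u)) h (B b) = 0 ->
  ((normal_covd phi g om i (normal_covd phi g om j N) u
    - normal_covd phi g om j (normal_covd phi g om i N) u)
    *m g u *m b^T) 0 0 = 0.
Proof.
move=> NO nN nb T; rewrite ricci_conformally_flat //.
have := triple_commutator (Bs (N u)) hs (Bs b) d0.
rewrite T mul0r /=; set K := _ *m _ => K0.
have {}K0 : K 1 0 = K 0 1 by apply/eqP; rewrite -subr_eq0 K0.
by case: (ord2P i) => ->; case: (ord2P j) => ->; rewrite ?K0 subrr.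
Qed.

(** Let [N u] and [b] be normal.  In the normal plane they are dependent with
    [a], whose second fundamental form is a multiple of [h]: hence those of
    [N u] and [b] are coplanar with [h], and the Ricci equation gives zero. *)
Lemma umbilic_normal_flat a l X Y N :
  a != 0 -> normal phi g u a -> B a = l *: h ->
  smooth_on O X -> smooth_on O Y ->
  smooth_on O N -> (forall v, O v -> normal phi g v (N v)) ->
  curvature (normal_conn G phi) X Y N u = 0.
Proof.
move=> a0 na Ba XO YO NO nN; rewrite curvature_normal_conn //.
rewrite big1 // => i _; rewrite big1 // => j _.
have nc k l' := normal_normal_covd hu om (normal_covd phi g om l' N) k Ou.
rewrite (normal_eq0 Ou (F := _ - _)) ?scaler0 //.
  by rewrite /normal !mulmxBl nc nc subr0.
move=> b nb; apply: ricci_coplanar => //.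
have K0 (v : 'rV[R]_4) : normal phi g u v -> v *m (g u *m (J u)^T) = 0.
  by rewrite mulmxA.
have [x [y [z [xyz E]]]] :=
  three_dependent (rank_conormal Ou) (K0 _ (nN u Ou)) (K0 _ nb) (K0 _ na).
have [xy|xy] := boolP ((x != 0) || (y != 0)).
  apply: (dependent_triple0 (z := - z * l) xy).
  rewrite -second_form_lincomb; move/eqP: E; rewrite addr_eq0 => /eqP ->.
  rewrite -scalerA -Ba -[- (z *: a)]scaleNr.
  by have := second_form_lincomb u a 0 (- z) 0; rewrite !scale0r !addr0.
move: xy xyz E; rewrite negb_or !negbK => /andP[/eqP -> /eqP ->].
rewrite eqxx /= !scale0r !add0r => z0 /eqP.
by rewrite scaler_eq0 (negbTE z0) (negbTE a0).
Qed.

(** For a basis of the normal plane, the Ricci equation makes the two second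
    fundamental forms coplanar with [h]; the coefficients of the relation are
    the coordinates of an umbilical direction. *)
Lemma normal_flat_umbilic :
  (forall N, smooth_on O N -> (forall v, O v -> normal phi g v (N v)) ->
     curvature (normal_conn G phi) (cst (e 0)) (cst (e 1)) N u = 0) ->
  exists a l, [/\ a != 0, normal phi g u a & B a = l *: h].
Proof.
move=> H; have [n1 [n2 [n10 n20 free]]] := plane_basis (rank_conormal Ou).
have nn1 : normal phi g u n1 by rewrite /normal -mulmxA.
have nn2 : normal phi g u n2 by rewrite /normal -mulmxA.
have NO := smooth_on_normal_extension n1.
have nN v : O v -> normal phi g v (normal_extension n1 v) := @normal_normal_extension n1 v.
have Nu := normal_extensionE nn1.
have basis_term (F : 'I_2 -> 'I_2 -> 'rV[R]_4) :
    \sum_i \sum_j (e 0 0 i * e 1 0 j) *: F i j = F 0 1.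
  by rewrite !sum_ord2 !mxE /= !(mul0r, mulr0, mul1r, scale0r, scale1r, add0r, addr0).
have T : triple (B n1) h (B n2) = 0.
  have := H _ NO nN; rewrite curvature_normal_conn //; try exact: smooth_on_cst.
  move=> /(etrans (esym (basis_term (fun i j => _)))) F0.
  have := ricci_conformally_flat 0 1 NO nN Ou nn2.
  rewrite F0 2!mul0mx Nu /= (_ : (0 : 'M[R]_1) 0 0 = 0) => [/esym|]; last by rewrite mxE.
  have := triple_commutator (Bs n1) hs (Bs n2) d0 => /= -> /eqP.
  by rewrite mulf_eq0 invr_eq0 (negbTE d0) orbF => /eqP.
have h0 : h 0 0 != 0 by rewrite gt_eqF //; have [] := positive_definite_symdet hs hpos.
have [x [y [z [xy E]]]] := triple0_dependent (Bs n1) hs (Bs n2) h0 T.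
exists (x *: n1 + y *: n2), z; split; last by rewrite second_form_lincomb.
  by apply: contraTneq xy => /free[-> ->]; rewrite eqxx.
exact: normal_lincomb.
Qed.

End AtPoint.

End ConformallyFlat.

End Bridge.

(** * Passage to the charts *)

Lemma open_smooth_preimage (R : realType) m n (O : set 'rV[R]_m) (U : set 'rV[R]_n)
    (phi : 'rV[R]_m -> 'rV[R]_n) :
  open O -> open U -> smooth_on O phi -> open (O `&` phi @^-1` U).
Proof.
move=> oO oU phiO; rewrite openE => u [Ou Uu]; rewrite /interior.
have phic := differentiable_continuous (smooth_on_differentiable phiO Ou).
apply: filterI; first exact: (open_nbhs_nbhs (conj oO Ou)).
exact: (phic U (open_nbhs_nbhs (conj oU Uu))).
Qed.

Lemma lorentzian_unit (R : realType) (G : 'M[R]_4) : lorentzian G -> G \in unitmx.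
Proof.
move=> [_ [P _ E]].
have : (Defs.minkowski : 'M[R]_4) \in unitmx.
  rewrite unitmxE det_diag unitfE; apply/prodf_neq0 => i _; rewrite mxE.
  by case: ifP => _; rewrite ?oppr_eq0 oner_eq0.
by rewrite -E !unitmx_mul => /andP[/andP[]].
Qed.

Lemma positive_definite_unit (R : realType) (h : 'M[R]_2) :
  h^T = h -> positive_definite h -> h \in unitmx.
Proof.
move=> hs /(positive_definite_symdet hs)[_ d0].
by have [] := invmx2 hs (lt0r_neq0 d0).
Qed.

Section LocalCharts.
Context {R : realType} {S : manifold R 2} {V : manifold R 4} (f : S -> V).
Hypothesis fc : continuous f.

(** Near [coord s q], the inverse chart takes its values in the open set
    [dom s `&` f @^-1` dom (f s)]. *)
Lemma open_local_dom s : open (local_dom f s).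
Proof.
rewrite openE => _ [q [sq fq] <-]; rewrite /interior.
have sx : (Defs.coord s @` dom s) (Defs.coord s q) by exists q.
have D : nbhs q (dom s `&` f @^-1` dom (f s)).
  apply: filterI; first exact: (open_nbhs_nbhs (conj (dom_open s) sq)).
  exact: (fc (open_nbhs_nbhs (conj (dom_open (f s)) fq))).
have pc : nbhs (Defs.coord s q) (param s @^-1` (dom s `&` f @^-1` dom (f s))).
  by apply: param_continuous sx _ _; rewrite /= coordK.
have sn := open_nbhs_nbhs (conj (@img_open _ _ S s) sx).
apply: (filterS _ (filterI sn pc)).
move=> _ [[q' sq' <-]] /=; rewrite coordK // => -[_ fq'].
by exists q'.
Qed.

Lemma local_dom_center s : local_dom f s (Defs.coord s s).
Proof. by exists s => //; split; exact: dom_center. Qed.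

Lemma local_rep_center s : local_rep f s (Defs.coord s s) = Defs.coord (f s) (f s).
Proof. by rewrite /local_rep /= coordK //; exact: dom_center. Qed.

End LocalCharts.

Theorem corollary1 (R : realType) (V : manifold R 4) (V_oriented : oriented V)
    (g : lorentz_metric V) (T : time_orientation g)
    (g_lcf : locally_conformally_flat g)
    (S : manifold R 2) (f : S -> V)
    (f_immersion : smooth_immersion f) (f_spacelike : spacelike g f) :
  umbilical_along_normal_direction g f <-> normal_curvature_vanishes g f.
Proof.
have [fc fsm _] := f_immersion.
have chart_data s (O : set 'rV[R]_2) : open O -> O `<=` local_dom f s ->
  forall U, open U -> U `<=` img (f s) ->
  let phi := local_rep f s in let G := g (f s) in
  let O' := O `&` phi @^-1` U in
  [/\ open O', smooth_on O' phi, smooth_on U G,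
      (forall x, U x -> (G x)^T = G x) /\ (forall x, U x -> G x \in unitmx) &
      (forall u, O' u -> positive_definite (gram phi (fun v => G (phi v)) u)) /\
      (forall u, O' u -> gram phi (fun v => G (phi v)) u \in unitmx)].
  move=> oO Osub U oU Usub phi G O'.
  have phiO : smooth_on O phi := smooth_on_restrict Osub (fsm s).
  have GL x : U x -> lorentzian (G x) by move=> /Usub; exact: metric_lorentzian.
  have Gs x : U x -> (G x)^T = G x by move=> /GL[].
  have hpos u : O' u -> positive_definite (gram phi (fun v => G (phi v)) u).
    by move=> [/Osub Ou _]; exact: f_spacelike.
  split.
  - exact: open_smooth_preimage.
  - by apply: smooth_on_restrict phiO => u [].
  - by apply: smooth_on_restrict Usub _; exact: metric_smooth.
  - by split=> // x /GL; exact: lorentzian_unit.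
  - split=> // u Ou; apply: positive_definite_unit (hpos u Ou).
    apply: (@gram_sym _ _ _ O' phi (fun v => G (phi v))) => // v [_ Uv]; exact: Gs.
split=> [H s O X Y N oO Ou Osub XO YO [NO nN] | H s].
  have [a [a0 na [D2 [N2 [oD2 D2u _ [N2D nN2] [N2u W]]]]]] := H s.
  (* All fields are restricted to the part of the surface that [phi] maps into
     the conformally flat neighbourhood. *)
  have [U [c [oU Up Usub cU flatU]]] := g_lcf (f s).
  have Uu : U (local_rep f s (Defs.coord s s)) by rewrite local_rep_center.
  have OOsub : O `&` D2 `<=` local_dom f s by move=> u [/Osub].
  have [oO' phiO' GU [Gs Gu] [hpos hu]] := chart_data s _ (openI oO oD2) OOsub U oU Usub.
  set O' := _ `&` _ in oO' phiO' hpos hu.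
  have phiU u : O' u -> U (local_rep f s u) by move=> [].
  have O'u : O' (Defs.coord s s) by [].
  have sO : O' `<=` O by move=> u [[]].
  have sD2 : O' `<=` D2 by move=> u [[]].
  have nP := @normal_atP R (g (f s)) (local_rep f s).
  have [l Bl] := (umbilicP oO' oU phiO' phiU GU Gs Gu hu (smooth_on_restrict sD2 N2D)
    (fun v O'v => (nP v _).1 (nN2 v (sD2 v O'v))) O'u).1 (ltac:(by rewrite N2u)).
  rewrite N2u in Bl.
  apply: (umbilic_normal_flat oO' oU phiO' phiU GU Gs Gu hu cU flatU O'u (hpos _ O'u)
    a0 ((nP _ _).1 na) Bl (smooth_on_restrict sO XO) (smooth_on_restrict sO YO)
    (smooth_on_restrict sO NO)).
  by move=> v O'v; exact: ((nP v _).1 (nN v (sO v O'v))).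
have [U [c [oU Up Usub cU flatU]]] := g_lcf (f s).
have Uu : U (local_rep f s (Defs.coord s s)) by rewrite local_rep_center.
have [oO' phiO' GU [Gs Gu] [hpos hu]] :=
  chart_data s _ (@open_local_dom _ _ _ f fc s) (@subset_refl _ _) U oU Usub.
set O' := _ `&` _ in oO' phiO' hpos hu.
have phiU u : O' u -> U (local_rep f s u) by move=> [].
have O'u : O' (Defs.coord s s) by split=> //; exact: local_dom_center.
have sO : O' `<=` local_dom f s by move=> u [].
have nP := @normal_atP R (g (f s)) (local_rep f s).
have flatN N : smooth_on O' N -> (forall v, O' v ->
      normal (local_rep f s) (fun w => g (f s) (local_rep f s w)) v (N v)) ->
    curvature (normal_conn (g (f s)) (local_rep f s))
      (cst (delta_mx 0 0)) (cst (delta_mx 0 1)) N (Defs.coord s s) = 0.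
  move=> NO nN.
  apply: (H s O' _ _ N oO' O'u sO (@smooth_on_cst _ _ _ O' _) (@smooth_on_cst _ _ _ O' _)).
  by split=> // v O'v; apply/nP; exact: nN.
have [a [l [a0 na Bl]]] := normal_flat_umbilic oO' oU phiO' phiU GU Gs Gu hu cU flatU O'u
  (hpos _ O'u) flatN.
have EN := normal_extensionE na.
exists a; split=> //; first exact/nP.
pose N := normal_extension (g (f s)) (local_rep f s) a.
have NO : smooth_on O' N := smooth_on_normal_extension oO' oU phiO' phiU GU hu a.
have nN v : O' v -> normal (local_rep f s) (fun w => g (f s) (local_rep f s w)) v (N v).
  exact: normal_normal_extension.
exists O', N; split=> //; first by split=> // v O'v; apply/nP; exact: nN.
split=> //; have := (umbilicP oO' oU phiO' phiU GU Gs Gu hu NO nN O'u).2.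
by rewrite /N EN; apply; exists l.
Qed.
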